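(* Let $\mathsf{M},\theta>0$ and put $M_N=\lfloor\mathsf{M}N\rfloor$. Let $\vec\ell$ be distributed according to the measure $\mathbb{P}^{\theta,M_N}_{\beta,N}$ defined in the context. The sequence of empirical measures $\mu_N:=\frac1N\sum_{i=1}^N\delta(\ell_i/N)$ converges weakly in probability, as $N\to\infty$, to the measure with density $\phi_\beta^{\theta,\mathsf{M}+\theta}$ given as follows. For $\mathsf{M}\ge\theta$, $$\phi_\beta^{\theta,\mathsf{M}+\theta}(x)=\begin{cases}(\theta\pi)^{-1}\operatorname{arccot}\left(\dfrac{\mathsf{M}-\theta}{2\sqrt{\mathsf{M}\theta-(x-(\mathsf{M}+\theta)/2)^2}}\right)&\text{for }|x-(\mathsf{M}+\theta)/2|<\sqrt{\mathsf{M}\theta},\\0&\text{for }|x-(\mathsf{M}+\theta)/2|\ge\sqrt{\mathsf{M}\theta}.\end{cases}$$ For $\mathsf{M}\in(0,\theta)$, $$\phi_\beta^{\theta,\mathsf{M}+\theta}(x)=\begin{cases}(\theta\pi)^{-1}\operatorname{arccot}\left(\dfrac{\mathsf{M}-\theta}{2\sqrt{\mathsf{M}\theta-(x-(\mathsf{M}+\theta)/2)^2}}\right)&\text{for }|x-(\mathsf{M}+\theta)/2|<\sqrt{\mathsf{M}\theta},\\\theta^{-1}&\text{for }\sqrt{\mathsf{M}\theta}\le|x-(\mathsf{M}+\theta)/2|\le(\mathsf{M}+\theta)/2,\\0&\text{for }|x-(\mathsf{M}+\theta)/2|>(\mathsf{M}+\theta)/2.\end{cases}$$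
   Context: For $\theta>0$ and $N,M\in\mathbb{N}$ (or $M \in \mathbb{Z}_{\geq 0}$), $\mathbb{W}^{\theta,M}_N$ is the set of $(\ell_1,\dots,\ell_N)$ with $\ell_i=\lambda_i+(N-i)\theta$, where $M\ge\lambda_1\ge\cdots\ge\lambda_N\ge0$ are integers. The probability measure $\mathbb{P}^{\theta,M}_{\beta,N}$ on $\mathbb{W}^{\theta,M}_N$ is $$\mathbb{P}^{\theta,M}_{\beta,N}(\vec\ell)=\frac1{Z}\prod_{1\le i<j\le N}\frac{\Gamma(\ell_i-\ell_j+\theta)\Gamma(\ell_i-\ell_j+1)}{\Gamma(\ell_i-\ell_j)\Gamma(\ell_i-\ell_j+1-\theta)}\prod_{i=1}^N\frac1{\Gamma(\ell_i+1)\,\Gamma(M+N\theta-\ell_i+1-\theta)},$$ with $Z$ the normalization constant. (The subscript $\beta$ is just a label.) $\operatorname{arccot}$ takes values in $(0,\pi)$. Convergence weakly in probability of $\mu_N$ to a measure with density $\phi$ means that for every bounded continuous real $f$ on $[0,\infty)$, $\int f\,d\mu_N-\int f(x)\phi(x)\,dx\to0$ in probability. *)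

(* Defs.v *)
From HB Require Import structures.
From mathcomp Require Import all_boot all_order all_algebra.
From mathcomp Require Import all_classical all_reals all_analysis.
From mathcomp Require Import measurable_realfun ring lra zify.

Set Implicit Arguments.
Unset Strict Implicit.
Unset Printing Implicit Defensive.

Import Order.TTheory GRing.Theory Num.Theory.
Import numFieldNormedType.Exports.

Local Open Scope classical_set_scope.
Local Open Scope ring_scope.

Section gamma_function.
Context {R : realType}.
Implicit Types x t : R.
Local Notation mu := (@lebesgue_measure R).

(* Euler's integral, which represents the Gamma function for 0 < x only; this
   covers every argument at which it is used below. *)
Definition Gamma x : R :=
  \int[mu]_(t in `]0, +oo[) (t `^ (x - 1) * expR (- t)).

Let g x t := t `^ (x - 1) * expR (- t).

Let g_ge0 x t : 0 <= g x t.
Proof. by rewrite mulr_ge0 ?powR_ge0 ?expR_ge0. Qed.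

Let mp (D : set R) (x : R) : measurable_fun D (fun t : R => t `^ x).
Proof. by apply: measurable_funTS; exact: measurable_powR. Qed.

Let mg x (D : set R) : measurable_fun D (fun t => (g x t)%:E).
Proof.
apply/measurable_EFinP/measurable_funM; first exact: mp.
apply: measurable_funTS; apply: measurableT_comp => //.
Qed.

Let gamma_near0 x : 0 < x -> (\int[mu]_(t in `]0%R, 1%R]) (g x t)%:E < +oo)%E.
Proof.
move=> x0; apply: (@le_lt_trans _ _ (x^-1)%:E); last by rewrite ltry.
have e0 n : 0 < (n.+2%:R : R)^-1 by rewrite invr_gt0.
have e1 n : (n.+2%:R : R)^-1 < 1 by rewrite invf_lt1// ltr1n.
pose F n : set R := `[(n.+2%:R)^-1, 1]%classic.
have UF : \bigcup_n F n = `]0, 1]%classic.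
  apply/seteqP; split => [t [n _]|t]; rewrite /F /= !in_itv/=.
    by move=> /andP[nt ->]; rewrite (lt_le_trans (e0 n) nt).
  move=> /andP[t0 t1]; exists (Num.truncn t^-1) => //=; rewrite in_itv/= t1 andbT.
  rewrite invf_ple ?posrE//.
  have ti : 0 <= t^-1 by rewrite invr_ge0 ltW.
  have /andP[_ /ltW /le_trans] := truncn_itv ti; apply.
  by rewrite ler_nat.
have bF n : (\int[mu]_(t in F n) (g x t)%:E <= (x^-1)%:E)%E.
  apply: (@le_trans _ _ (\int[mu]_(t in F n) (t `^ (x - 1))%:E)%E).
    apply: ge0_le_integral => //.
    - exact: measurable_itv.
    - by move=> t _; rewrite lee_fin.
    - exact: mg.
    - by apply/measurable_EFinP; exact: mp.
    - move=> t; rewrite /F /= in_itv/= => /andP[nt t1].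
      rewrite lee_fin ler_piMr ?powR_ge0// -expR0 ler_expR oppr_le0.
      exact: le_trans (ltW (e0 n)) nt.
  have D t : 0 < t -> is_derive t 1 (fun t : R => x^-1 * t `^ x) (t `^ (x - 1)).
    move=> t0; have := @is_deriveZ _ _ _ _ x^-1 _ _ _ (is_derive1_powR x t0).
    by rewrite /GRing.scale/= mulrA mulVf ?gt_eqF// mul1r.
  rewrite (@continuous_FTC2 _ _ (fun t : R => x^-1 * t `^ x))//.
  - rewrite powR1 mulr1 -EFinB lee_fin lerBlDr lerDl.
    by rewrite mulr_ge0 ?powR_ge0// invr_ge0 ltW.
  - apply: continuous_in_subspaceT => t; rewrite inE/= in_itv/= => /andP[nt _].
    apply: differentiable_continuous; apply/derivable1_diffP.
    apply: derivable_powR.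
    by rewrite in_itv/= andbT (lt_le_trans (e0 n)).
  - have C t : 0 < t -> {for t, continuous (fun t : R => x^-1 * t `^ x)}.
      move=> t0; apply: differentiable_continuous; apply/derivable1_diffP.
      by have [] := D t t0.
    split.
    + move=> t; rewrite in_itv/= => /andP[nt _].
      by have [] := D t (lt_trans (e0 n) nt).
    + by apply: cvg_at_right_filter; exact: C.
    + by apply: cvg_at_left_filter; exact: C.
  - move=> t; rewrite in_itv/= => /andP[nt _].
    by rewrite derive1E; have [_ ->] := D t (lt_trans (e0 n) nt).
have nF : nondecreasing_seq F.
  move=> m n mn; apply/subsetPset => t; rewrite /F /= !in_itv/=.
  move=> /andP[mt ->]; rewrite andbT; apply: le_trans mt.
  by rewrite lef_pV2 ?posrE// ler_nat.
have h : (\int[mu]_(t in F n) (g x t)%:E)%E @[n --> \oo] -->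
    (\int[mu]_(t in \bigcup_n F n) (g x t)%:E)%E.
  apply: ge0_nondecreasing_set_cvg_integral => //.
  - by move=> n; exact: measurable_itv.
  - by move=> n; exact: mg.
  - by move=> n t _; rewrite lee_fin.
rewrite -UF -(cvg_lim _ h)//; apply: lime_le.
  by apply/cvg_ex; eexists; exact: h.
by near=> n; exact: bF.
Unshelve. all: by end_near. Qed.

Let gamma_nearoo x : (\int[mu]_(t in `]1%R, +oo[) (g x t)%:E < +oo)%E.
Proof.
pose k := 2 * `|x - 1| + 1.
have k0 : 0 < k by rewrite ltr_wpDl// mulr_ge0.
pose C := 2 * expR (`|x - 1| * `|ln k|).
have gC t : 1 < t -> g x t <= C * exponential_pdf 2^-1 t.
  move=> t1; have t0 : 0 < t by apply: lt_trans t1.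
  rewrite (exponential_pdfE _ (ltW t0)).
  rewrite /g /C mulrACA divff// mul1r /powR gt_eqF//.
  rewrite -!expRD ler_expR.
  have lt0 : 0 <= ln t by apply: ln_ge0; exact: ltW.
  have A : (x - 1) * ln t <= `|x - 1| * ln t by rewrite ler_wpM2r// ler_norm.
  have B : ln t <= ln k + t / k.
    have tk : 0 < t / k by rewrite divr_gt0.
    have -> : ln t = ln k + ln (t / k).
      by rewrite ln_div ?posrE//; ring.
    by rewrite lerD2l ltW// ln_sublinear.
  have A' : `|x - 1| * ln t <= `|x - 1| * (`|ln k| + t / k).
    by rewrite ler_wpM2l// (le_trans B)// lerD2r ler_norm.
  have E : `|x - 1| * (t / k) <= t / 2.
    rewrite mulrCA (ler_wpM2l (ltW t0))//.
    rewrite ler_pdivrMr// /k; lra.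
  lra.
have C0 : 0 <= C by rewrite mulr_ge0// expR_ge0.
pose h t := C * exponential_pdf 2^-1 t.
have h0 t : 0 <= h t by rewrite mulr_ge0// exponential_pdf_ge0.
have mh (D : set R) : measurable_fun D (fun t => (h t)%:E).
  apply/measurable_EFinP/measurable_funTS/measurable_funM => //.
  exact: measurable_exponential_pdf.
apply: (@le_lt_trans _ _ (\int[mu]_t (h t)%:E)%E).
  apply: (@le_trans _ _ (\int[mu]_(t in `]1%R, +oo[) (h t)%:E)%E).
    apply: ge0_le_integral => //.
    - by move=> t _; rewrite lee_fin.
    - exact: mg.
    - exact: mh.
    - by move=> t; rewrite /= in_itv/= andbT => t1; rewrite lee_fin gC.
  apply: ge0_subset_integral => //; first exact: mh.
  by move=> t _; rewrite lee_fin.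
under eq_integral do rewrite EFinM.
rewrite ge0_integralZl//.
- by rewrite integral_exponential_pdf// mule1 ltry.
- by apply/measurable_EFinP; exact: measurable_exponential_pdf.
- by move=> t _; rewrite lee_fin exponential_pdf_ge0.
Qed.

Lemma Gamma_integral_lty x : 0 < x ->
  (\int[mu]_(t in `]0%R, +oo[) (t `^ (x - 1) * expR (- t))%:E < +oo)%E.
Proof.
move=> x0.
have -> : `]0, +oo[%classic = `]0, 1]%classic `|` `]1, +oo[%classic :> set R.
  by rewrite -itv_bndbnd_setU// bnd_simp.
rewrite ge0_integral_setU//=.
- by rewrite lte_add_pinfty// ?gamma_near0// gamma_nearoo.
- exact: (@mg x).
- by move=> t _; rewrite lee_fin g_ge0.
- apply/disj_setPS => t /= []; rewrite !in_itv/= andbT => /andP[_ t1].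
  by rewrite ltNge t1.
Qed.

Lemma Gamma_gt0 x : 0 < x -> 0 < Gamma x.
Proof.
move=> x0; rewrite /Gamma /Rintegral fine_gt0//.
rewrite Gamma_integral_lty// andbT.
have c0 : 0 < expR (- `|x - 1| - 2) :> R by exact: expR_gt0.
apply: (@lt_le_trans _ _ (\int[mu]_(t in `[1%R, 2%R]) (expR (- `|x - 1| - 2))%:E)%E).
  rewrite integral_cst//= lebesgue_measure_itv/= lte_fin ltr1n/=.
  by rewrite -EFinB -EFinM lte_fin mulr_gt0// subr_gt0 ltr1n.
apply: (@le_trans _ _ (\int[mu]_(t in `[1%R, 2%R]) (g x t)%:E)%E).
  apply: ge0_le_integral => //.
  - exact: mg.
  - move=> t; rewrite /= in_itv/= => /andP[t1 t2].
    have t0 : 0 < t by apply: lt_le_trans t1.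
    rewrite lee_fin /g /powR gt_eqF// -expRD ler_expR.
    have lt0 : 0 <= ln t by apply: ln_ge0.
    have lt1 : ln t <= 1.
      have := @le_ln1Dx R (t - 1); rewrite (addrC 1) subrK => h.
      have : ln t <= t - 1 by apply: h; lra.
      lra.
    have : - ((x - 1) * ln t) <= `|x - 1|.
      rewrite (le_trans (ler_norm _))// normrN normrM ler_piMr//.
      by rewrite ger0_norm.
    lra.
apply: ge0_subset_integral => //.
- exact: mg.
- by move=> t _; rewrite lee_fin g_ge0.
- move=> t /=; rewrite !in_itv/= andbT => /andP[t1 _].
  exact: lt_le_trans t1.
Qed.

End gamma_function.

Section arccot.
Context {R : realType}.

Definition arccot (x : R) : R := pi / 2 - atan x.

Lemma arccot_gt0 x : 0 < arccot x.
Proof. by rewrite subr_gt0 atan_ltpi2. Qed.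

Lemma arccot_ltpi x : arccot x < pi.
Proof. have := atan_gtNpi2 x; rewrite /arccot; lra. Qed.

Lemma arccotK x : cos (arccot x) / sin (arccot x) = x.
Proof.
rewrite /arccot cosB sinB cos_pihalf sin_pihalf !mul0r !mul1r add0r subr0.
by rewrite -[RHS]atanK.
Qed.

End arccot.

(* Sequences M >= lam_1 >= ... >= lam_N >= 0. Such a lam encodes the point ell lam
   of W^{theta,M}_N, and the sigma-algebra is the discrete one. *)
Definition box_partition (N M : nat) :=
  {lam : N.-tuple 'I_M.+1 | sorted geq [seq val k | k <- lam]}.

HB.instance Definition _ N M := Finite.on (box_partition N M).

Fact zero_partition_subproof N M :
  sorted geq [seq val k | k <- [tuple of nseq N (@ord0 M)]].
Proof. by rewrite map_nseq; case: N => //=; elim. Qed.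

HB.instance Definition _ N M := isPointed.Build (box_partition N M)
  (exist _ [tuple of nseq N (@ord0 M)] (zero_partition_subproof N M)).

HB.instance Definition _ N M := @isMeasurable.Build default_measure_display
  (box_partition N M) (@discrete_measurable _)
  (@discrete_measurable0 _) (@discrete_measurableC _) (@discrete_measurableU _).

Section discrete_ensemble.
Context {R : realType}.
Variable theta : R.

(* The index i runs from 0 to N - 1, so the shift (N - i) theta of the i-th
   coordinate counted from 1 becomes (N - i.+1) theta. *)
Definition ell N M (lam : box_partition N M) (i : nat) : R :=
  (nth 0%N [seq val k | k <- val lam] i)%:R + (N - i.+1)%:R * theta.

Definition weight (N M : nat) (l : nat -> R) : R :=
  (\prod_(i < N) \prod_(j < N | (i < j)%N)
     (Gamma (l i - l j + theta) * Gamma (l i - l j + 1) /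
      (Gamma (l i - l j) * Gamma (l i - l j + 1 - theta)))) *
  \prod_(i < N)
     (Gamma (l i + 1) * Gamma (M%:R + N%:R * theta - l i + 1 - theta))^-1.

Definition partition_function N M : R :=
  \sum_(lam : box_partition N M) weight N M (ell lam).

Definition ensemble_pmf N M (lam : box_partition N M) : R :=
  weight N M (ell lam) / partition_function N M.

Hypothesis theta_gt0 : 0 < theta.

Lemma ell_diff N M (lam : box_partition N M) i j : (i < j < N)%N ->
  (j - i)%:R * theta <= ell lam i - ell lam j.
Proof.
move=> /andP[ij jN]; have := svalP lam; rewrite /ell.
set s := [seq val k | k <- val lam] => ss.
have sz : size s = N by rewrite size_map size_tuple.
have h : (nth 0 s j <= nth 0 s i)%N.
  have tr : transitive geq by move=> a b c ba cb; exact: leq_trans cb ba.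
  apply: (sorted_leq_nth tr leqnn 0%N ss) (ltnW ij); rewrite inE sz//.
  exact: ltn_trans jN.
have -> : (N - i.+1 = (N - j.+1) + (j - i))%N by lia.
rewrite natrD mulrDl; move: h; rewrite -(ler_nat R); lra.
Qed.

Lemma ell_ge0 N M (lam : box_partition N M) i : 0 <= ell lam i.
Proof. by rewrite addr_ge0// mulr_ge0// ltW. Qed.

Lemma ell_le N M (lam : box_partition N M) i : (i < N)%N ->
  ell lam i <= M%:R + (N%:R - 1) * theta.
Proof.
move=> iN; rewrite /ell lerD//.
  rewrite ler_nat (nth_map ord0) ?size_tuple//.
  by rewrite -ltnS; exact: ltn_ord.
rewrite ler_wpM2r ?(ltW theta_gt0)// lerBrDr natr1 ler_nat; lia.
Qed.

Lemma weight_gt0 N M (lam : box_partition N M) : 0 < weight N M (ell lam).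
Proof.
rewrite /weight mulr_gt0//; apply: prodr_gt0 => i _.
  apply: prodr_gt0 => j ij.
  have h : (j - i)%:R * theta <= ell lam i - ell lam j.
    by apply: ell_diff; rewrite ij ltn_ord.
  have h1 : theta <= ell lam i - ell lam j.
    by apply: le_trans h; rewrite ler_peMl ?(ltW theta_gt0)// ler1n subn_gt0.
  have t0 := theta_gt0.
  by rewrite divr_gt0// mulr_gt0// Gamma_gt0//; lra.
have := @ell_le _ _ lam i (ltn_ord i); have := ell_ge0 lam i.
rewrite mulrBl mul1r => h0 h1.
by rewrite invr_gt0 mulr_gt0// Gamma_gt0//; lra.
Qed.

Lemma partition_function_gt0 N M : 0 < partition_function N M.
Proof.
rewrite /partition_function (bigD1 (point : box_partition N M))//= ltr_pwDl ?weight_gt0//.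
by apply: sumr_ge0 => ? _; rewrite ltW ?weight_gt0.
Qed.

Lemma ensemble_pmf_gt0 N M (lam : box_partition N M) : 0 < ensemble_pmf lam.
Proof. by rewrite divr_gt0 ?weight_gt0 ?partition_function_gt0. Qed.

Lemma ensemble_pmf_sum1 N M : \sum_(lam : box_partition N M) ensemble_pmf lam = 1.
Proof. by rewrite -mulr_suml divff// gt_eqF// partition_function_gt0. Qed.

End discrete_ensemble.

(* The argument theta_gt0 is not used in the formula; it is kept because
   0 < theta is what makes the total mass equal to 1. *)
Definition ensemble_prob {R : realType} (theta : R) (theta_gt0 : 0 < theta)
    (N M : nat) : set (box_partition N M) -> \bar R :=
  fun A => (\sum_(lam \in A) (ensemble_pmf theta lam)%:E)%E.

Section ensemble_probability.
Context {R : realType} (theta : R) (theta_gt0 : 0 < theta) (N M : nat).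
Local Notation P := (@ensemble_prob R theta theta_gt0 N M).
Local Notation pmf := (@ensemble_pmf R theta N M).

Let pmf_ge0 lam : (0 <= (pmf lam)%:E)%E.
Proof. by rewrite lee_fin ltW// ensemble_pmf_gt0. Qed.

Let P0 : P set0 = 0%E.
Proof. by rewrite /ensemble_prob fsbig_set0. Qed.

Let P_ge0 A : (0 <= P A)%E.
Proof. by rewrite /ensemble_prob fsume_ge0. Qed.

Let P_sigma_additive : semi_sigma_additive P.
Proof.
move=> F mF tF mUF; rewrite /ensemble_prob; apply: cvg_toP.
  apply: ereal_nondecreasing_is_cvgn => m n mn.
  by apply: lee_sum_nneg_natr => // k _ _; rewrite fsume_ge0.
transitivity (\sum_(0 <= i <oo) (\esum_(j in F i) (pmf j)%:E))%E.
  by apply: eq_eseriesr => k _; rewrite esum_fset//; exact: finite_finset.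
by rewrite -nneseries_sum_bigcup//= esum_fset//; exact: finite_finset.
Qed.

HB.instance Definition _ := isMeasure.Build _ _ _ P P0 P_ge0 P_sigma_additive.

Let P_setT : P [set: _] = 1%E.
Proof.
rewrite /= /ensemble_prob (fsbigE (index_enum (box_partition N M))).
- under eq_bigl do rewrite in_setT.
  by rewrite sumEFin ensemble_pmf_sum1.
- exact: index_enum_uniq.
- by [].
- by move=> lam _; rewrite mem_index_enum.
Qed.

HB.instance Definition _ := @Measure_isProbability.Build _ _ R P P_setT.

End ensemble_probability.

Section limit.
Context {R : realType}.

Definition empirical_measure (N : nat) (l : nat -> R) : {measure set R -> \bar R} :=
  mscale (N%:R^-1)%:nng (msum (fun i => \d_(l i / N%:R)) N).

Definition cvg_in_probability (d : nat -> measure_display)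
    (T : forall n, measurableType (d n)) (P : forall n, probability (T n) R)
    (X : forall n, T n -> R) (c : R) : Prop :=
  forall e, 0 < e -> P n [set w | e <= `|X n w - c|] @[n --> \oo] --> 0%E.

Definition weakly_cvg_in_probability (d : nat -> measure_display)
    (T : forall n, measurableType (d n)) (P : forall n, probability (T n) R)
    (mu : forall n, T n -> {measure set R -> \bar R}) (phi : R -> R) : Prop :=
  forall f : R -> R, {within `[0, +oo[, continuous f} ->
    [bounded f x | x in `[0, +oo[] ->
    cvg_in_probability P
      (fun n w => \int[mu n w]_(x in `[0, +oo[) f x)
      (\int[lebesgue_measure]_(x in `[0, +oo[) (f x * phi x)).

Definition limit_density (theta M x : R) : R :=
  let y := x - (M + theta) / 2 in
  let bulk := (theta * pi)^-1 *
    arccot ((M - theta) / (2 * Num.sqrt (M * theta - y ^+ 2))) in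
  if theta <= M then
    if `|y| < Num.sqrt (M * theta) then bulk else 0
  else
    if `|y| < Num.sqrt (M * theta) then bulk
    else if `|y| <= (M + theta) / 2 then theta^-1
    else 0.

End limit.

(* Main.v *)
Require Import Defs.
From mathcomp Require Import all_boot all_order all_algebra.
From mathcomp Require Import all_classical all_reals all_analysis.
From mathcomp Require Import measurable_realfun ring lra zify.

(** The ensemble is the stationary law of a reversible jump process: removing a
    box from, or adding a box to, the row [i] moves the coordinate [ell_i] by
    one, and the rates [down_rate] and [up_rate] satisfy detailed balance because
    the Gamma function obeys [Gamma (x + 1) = x * Gamma x]. These rates are also
    the residues of the discrete loop (Nekrasov) expression
      [(w + 1 + T) * prod_j (1 - theta / (w + 1 + ell_j))
        - w * prod_j (1 + theta / (w + ell_j)) - constant],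
    which, for the present one-body weight, equals for every configuration the
    sum of its polar parts ([loop_identity]). Hence its product with an
    observable has as mean a sum over jumps of the increments of the observable
    ([reversibility]).

    Take [w = s * N] with [s > 0]. The expression divided by [N] is then
    [loop_function] at the Stieltjes transform [X = N^-1 * sum_i 1 / (x_i + s)],
    [x_i = ell_i / N], up to [O(1/N)] ([loop_expression_dist]). The loop function
    is strictly decreasing; let [S] be its root. With the observable [X - S],
    whose increments are [O(N ^- 2)], the mean of the product of the expression
    by [X - S] is at least [- O(1/N)], whereas monotonicity makes that product,
    divided by [- N], at least a multiple of [(X - S) ^+ 2] up to [O(1/N)]. So
    [X] tends to [S] in mean square ([mean_square_bound]); concentration and
    identification of the limit come out of the same computation.

    It remains to see that [S] is the Stieltjes transform of the stated density
    ([loop_function_limit]). The density is a mixture, over a parameter [t]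
    between [(M - theta) / 2] and [(M + theta) / 2], of arcsine densities on the
    intervals centred at [(M + theta) / 2] with squared radius
    [((M + theta) / 2) ^+ 2 - t ^+ 2] ([limit_density_arcsine_mixture]); this
    covers both signs of [M - theta]. By Tonelli's theorem and the elementary
    transform of the arcsine law, [S] is an explicit logarithm, which solves the
    loop equation.

    Convergence of all Stieltjes transforms at negative points implies that of
    the moments and, by Weierstrass' theorem on the segment [0, M + theta] that
    carries all the measures, that of every continuous test function. *)

Set Implicit Arguments.
Unset Strict Implicit.
Unset Printing Implicit Defensive.

Import Order.TTheory GRing.Theory Num.Theory.
Import numFieldNormedType.Exports.

Local Open Scope classical_set_scope.
Local Open Scope ring_scope.

(** * Improper integrals by antiderivatives *)

Section improper_ftc.
Context {R : realType}.
Local Notation mu := (@lebesgue_measure R).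
Implicit Types (f F : R -> R) (a b : R).

Lemma ftc_segment f F a b : a <= b ->
  (forall x, a <= x <= b -> {for x, continuous f}) ->
  (forall x, a <= x <= b -> is_derive x 1 F (f x)) ->
  (\int[mu]_(x in `[a, b]) (f x)%:E = (F b - F a)%:E)%E.
Proof.
rewrite le_eqVlt => /predU1P[<- _ _|ab cf dF].
  by rewrite set_itv1 integral_set1 subrr.
have cF x : a <= x <= b -> {for x, continuous F}.
  move=> /dF h; apply: differentiable_continuous; apply/derivable1_diffP.
  by have [] := h.
rewrite (@continuous_FTC2 _ f F)// ?EFinB//.
- by apply: continuous_in_subspaceT => x; rewrite inE/= in_itv/=; exact: cf.
- split.
  + by move=> x; rewrite in_itv/= => /andP[ax xb]; have [] := dF x; rewrite ?ltW.
  + by apply: cvg_at_right_filter; apply: cF; rewrite lexx ltW.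
  + by apply: cvg_at_left_filter; apply: cF; rewrite lexx ltW.
- move=> x; rewrite in_itv/= => /andP[ax xb].
  have axb : a <= x <= b by rewrite !ltW.
  by rewrite derive1E; have [_ ->] := dF x axb.
Qed.

Lemma ge0_exhaustion_ftc f F (D : set R) (a b : nat -> R) (l : R) :
  \bigcup_n `[a n, b n]%classic = D ->
  nondecreasing_seq (fun n => `[a n, b n]%classic) ->
  (forall n, a n <= b n) ->
  (forall x, D x -> 0 <= f x) ->
  (forall x, D x -> {for x, continuous f}) ->
  (forall x, D x -> is_derive x 1 F (f x)) ->
  F (b n) - F (a n) @[n --> \oo] --> l ->
  (\int[mu]_(x in D) (f x)%:E = l%:E)%E.
Proof.
move=> UD ndD ab f0 cf dF Fl.
have inD n x : a n <= x <= b n -> D x.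
  by move=> h; rewrite -UD; exists n => //=; rewrite in_itv.
have cvgD : (\int[mu]_(x in `[a n, b n]) (f x)%:E)%E @[n --> \oo] -->
    (\int[mu]_(x in D) (f x)%:E)%E.
  rewrite -UD; apply: ge0_nondecreasing_set_cvg_integral => //.
  - move=> n; apply/measurable_EFinP; apply: subspace_continuous_measurable_fun => //.
    have : {within `[a n, b n], continuous f}; last exact.
    by apply: continuous_in_subspaceT => x; rewrite inE/= in_itv/= => /inD/cf.
  - by move=> n x /=; rewrite in_itv/= => /inD/f0; rewrite lee_fin.
rewrite -(cvg_lim _ cvgD)//; apply/cvg_lim => //.
have -> : (fun n => \int[mu]_(x in `[a n, b n]) (f x)%:E)%E =
    (fun n => (F (b n) - F (a n))%:E).
  by apply/funext => n; apply: ftc_segment => // x /inD; [exact: cf|exact: dF].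
by apply: cvg_EFin; [exact: nearW|exact: Fl].
Qed.

(** Only one-sided limits of the antiderivative matter, so the integrand may
    blow up at both ends. *)
Lemma ge0_open_ftc f F a b (la lb : R) : a < b ->
  (forall x, a < x < b -> 0 <= f x) ->
  (forall x, a < x < b -> {for x, continuous f}) ->
  (forall x, a < x < b -> is_derive x 1 F (f x)) ->
  F x @[x --> a^'+] --> la -> F x @[x --> b^'-] --> lb ->
  (\int[mu]_(x in `]a, b[) (f x)%:E = (lb - la)%:E)%E.
Proof.
move=> ab f0 cf dF Fa Fb.
pose e n : R := (b - a) / 2 / n.+1%:R.
have ba : 0 < b - a by rewrite subr_gt0.
have e0 n : 0 < e n by rewrite !divr_gt0.
have ele n : e n <= (b - a) / 2.
  by rewrite ler_pdivrMr// ler_peMr ?ler1n// divr_ge0// ltW.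
have end0 m n : (m <= n)%N -> e n <= e m.
  by move=> mn; rewrite ler_pM2l ?divr_gt0// lef_pV2 ?posrE// ler_nat.
have ecvg : e n @[n --> \oo] --> (0 : R).
  rewrite -[X in _ --> X](mulr0 ((b - a) / 2)).
  by apply: cvgM; [exact: cvg_cst|exact: cvg_harmonic].
apply: (@ge0_exhaustion_ftc f F _ (fun n => a + e n) (fun n => b - e n)) => //.
- apply/seteqP; split => [x [n _]|x]/=; rewrite !in_itv/= => /andP[ax xb].
    have := e0 n; lra.
  pose d := Num.min (x - a) (b - x).
  have d0 : 0 < d by rewrite lt_min !subr_gt0 ax.
  have [n _ /(_ n (leqnn n))/=] : \forall n \near \oo, e n < d.
    by apply: (cvgr_lt 0) => //.
  rewrite lt_min => /andP[h1 h2].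
  exists n => //=; rewrite in_itv/=; lra.
- move=> m n mn; apply/subsetPset => x /=; rewrite !in_itv/=.
  have := end0 _ _ mn; lra.
- move=> n; have := ele n; lra.
- have right n : a < a + e n by rewrite ltrDl.
  have left n : b - e n < b by rewrite ltrBlDr ltrDl.
  apply: cvgB.
  + apply: ((cvg_at_leftP F b lb).1 Fb (fun n => b - e n)); split => //.
    by rewrite -[X in _ --> X]subr0; apply: cvgB; [exact: cvg_cst|exact: ecvg].
  + apply: ((cvg_at_rightP F a la).1 Fa (fun n => a + e n)); split => //.
    by rewrite -[X in _ --> X]addr0; apply: cvgD; [exact: cvg_cst|exact: ecvg].
Qed.

End improper_ftc.

(** * The functional equation of the Gamma function *)

Section gamma_recursion.
Context {R : realType}.
Local Notation mu := (@lebesgue_measure R).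
Implicit Types x t : R.

Let g x t : R := t `^ (x - 1) * expR (- t).

Let D : set R := `]0, +oo[%classic.

Lemma Gamma_integrand_ge0 x t : 0 <= t `^ (x - 1) * expR (- t).
Proof. by rewrite mulr_ge0 ?powR_ge0 ?expR_ge0. Qed.

Let mg x (A : set R) : measurable_fun A (fun t => (g x t)%:E).
Proof.
apply/measurable_EFinP/measurable_funM; apply: measurable_funTS.
  exact: measurable_powR.
exact: measurableT_comp.
Qed.

Lemma Gamma_integrable x : 0 < x ->
  mu.-integrable `]0%R, +oo[ (fun t => (t `^ (x - 1) * expR (- t))%:E).
Proof.
move=> x0; apply/integrableP; split; first exact: (@mg x).
under eq_integral do rewrite gee0_abs ?lee_fin ?Gamma_integrand_ge0//.
exact: Gamma_integral_lty.
Qed.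

Let dF x t : 0 < t ->
  is_derive t 1 (fun t => - (t `^ x * expR (- t))) (g (x + 1) t - x * g x t).
Proof.
move=> t0; have h := is_derive1_powR x t0.
apply: is_derive_eq; rewrite /g /GRing.scale/= addrK; ring.
Qed.

Let cF x t : 0 < t -> {for t, continuous (g x)}.
Proof.
move=> t0; have h := is_derive1_powR (x - 1) t0.
have : is_derive t 1 (g x) (t `^ (x - 1) * - expR (- t)
    + expR (- t) * ((x - 1) * t `^ (x - 1 - 1))).
  apply: is_derive_eq; rewrite /GRing.scale/=; ring.
by case=> /derivable1_diffP/differentiable_continuous.
Qed.

(** ln t <= ln k + t / k turns the exponent x ln t - t into at most
   x ln k - t / 2 for k = 2 x, and exp (- t / 2) <= 2 / t. *)
Let boundary_oo x t : 0 < x -> 0 < t ->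
  t `^ x * expR (- t) <= 2 * expR (x * ln (2 * x)) / t.
Proof.
move=> x0 t0; rewrite ler_pdivlMr// /powR gt_eqF// -expRD.
have B : ln t <= ln (2 * x) + t / (2 * x).
  have tk : 0 < t / (2 * x) by rewrite divr_gt0// mulr_gt0.
  have -> : ln t = ln (2 * x) + ln (t / (2 * x)).
    by rewrite ln_div ?posrE// ?mulr_gt0//; ring.
  by rewrite lerD2l ltW// ln_sublinear.
have E : x * ln t - t <= x * ln (2 * x) - t / 2.
  have : x * ln t <= x * (ln (2 * x) + t / (2 * x)) by rewrite ler_wpM2l// ltW.
  have -> : x * (ln (2 * x) + t / (2 * x)) = x * ln (2 * x) + t / 2.
    by field; rewrite gt_eqF.
  lra.
apply: (@le_trans _ _ (expR (x * ln (2 * x) - t / 2) * t)).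
  by rewrite ler_wpM2r ?(ltW t0)// ler_expR.
rewrite expRD mulrC mulrCA mulrC ler_wpM2r ?expR_ge0//.
rewrite expRN ler_pdivrMr ?expR_gt0//.
have := expR_ge1Dx (t / 2); lra.
Qed.

(** Integration by parts: the two integrands differ by the derivative of
    [- t `^ x * expR (- t)], whose boundary terms vanish along the segments
    [1 / n, n] that exhaust the half-line. *)
Lemma GammaS x : 0 < x -> Gamma (x + 1) = x * Gamma x.
Proof.
move=> x0; have x10 : 0 < x + 1 by rewrite addr_gt0.
pose b n : R := n.+2%:R; pose a n : R := (b n)^-1.
have b1 n : 1 <= b n by rewrite ler1n.
have b0 n : 0 < b n by rewrite ltr0n.
have a0 n : 0 < a n by rewrite invr_gt0.
have ab n : a n <= b n by rewrite (@le_trans _ _ 1)// invf_le1.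
pose F n : set R := `[a n, b n]%classic.
have FD n : F n `<=` D.
  move=> t; rewrite /F/D/= !in_itv/= andbT => /andP[+ _].
  exact: lt_le_trans (a0 n).
have ndF : nondecreasing_seq F.
  move=> m n mn; apply/subsetPset => t; rewrite /F/= !in_itv/= => /andP[at_ tb].
  have bmn : b m <= b n by rewrite ler_nat !ltnS.
  by rewrite (le_trans tb bmn) (le_trans _ at_)// lef_pV2 ?posrE.
have UF : \bigcup_n F n = D.
  apply/seteqP; split=> [t [n _ /FD]//|t]; rewrite /D/= in_itv/= andbT => t0.
  pose n := Num.truncn (Num.max t t^-1).
  have m0 : 0 <= Num.max t t^-1 by rewrite le_max ltW.
  have /andP[_ /ltW nm] := truncn_itv m0.
  have {}nm : Num.max t t^-1 <= b n by rewrite (le_trans nm)// ler_nat.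
  move: nm; rewrite ge_max => /andP[h1 h2].
  by exists n => //=; rewrite /F/= in_itv/= h1 andbT /a invf_ple ?posrE.
pose I x n : R := \int[mu]_(t in F n) g x t.
have IE (y : R) : 0 < y -> I y n @[n --> \oo] --> Gamma y.
  move=> y0; apply: fine_cvg.
  rewrite fineK; last exact: (integrable_fin_num _ (Gamma_integrable y0)).
  rewrite -/D -UF; apply: ge0_nondecreasing_set_cvg_integral => //.
  - by move=> n; exact: measurable_itv.
  - by move=> n; exact: mg.
  - by move=> n t _; rewrite lee_fin Gamma_integrand_ge0.
have int (y : R) n : 0 < y -> mu.-integrable (F n) (EFin \o g y).
  move=> y0; have mD : measurable D by exact: measurable_itv.
  have mF : measurable (F n) by exact: measurable_itv.
  exact: (@integrableS _ _ R mu _ _ _ mD mF (FD n) (Gamma_integrable y0)).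
have step n : I (x + 1) n - x * I x n =
    a n `^ x * expR (- a n) - b n `^ x * expR (- b n).
  rewrite /I -RintegralZl//; [|exact: measurable_itv|exact: int].
  rewrite -RintegralB//; [|exact: measurable_itv|exact: int|]; last first.
    by apply: (integrableZl _ x (int x n x0)); exact: measurable_itv.
  have E : (\int[mu]_(t in F n) (g (x + 1) t - x * g x t)%:E =
      (- (b n `^ x * expR (- b n)) - - (a n `^ x * expR (- a n)))%:E)%E.
    apply: (@ftc_segment _ _ (fun t => - (t `^ x * expR (- t)))) => //.
    - move=> t /andP[h _]; have t0 := lt_le_trans (a0 n) h.
      by apply: cvgB; [exact: cF|apply: cvgM; [exact: cvg_cst|exact: cF]].
    - by move=> t /andP[h _]; apply: dF; exact: lt_le_trans h.
  by rewrite /Rintegral E /=; ring.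
have bn0 : (b n)^-1 @[n --> \oo] --> (0 : R).
  have := @cvg_harmonic R; rewrite -cvg_shiftS; exact.
have lim0 : I (x + 1) n - x * I x n @[n --> \oo] --> (0 : R).
  rewrite (_ : (fun n => _) = (fun n => a n `^ x * expR (- a n) -
    b n `^ x * expR (- b n))); last by apply/funext => n; exact: step.
  rewrite -[X in _ --> X](subr0 0); apply: cvgB.
    apply: (@squeeze_cvgr _ _ _ _ (fun=> 0) (fun n => a n `^ x)).
    - near=> n; rewrite mulr_ge0 ?powR_ge0 ?expR_ge0//= ler_piMr ?powR_ge0//.
      by rewrite -expR0 ler_expR oppr_le0 ltW.
    - exact: cvg_cst.
    - by apply: ((cvg_at_rightP _ _ _).1 (powR_cvg0 x0) a); split.
  apply: (@squeeze_cvgr _ _ _ _ (fun=> 0)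
      (fun n => 2 * expR (x * ln (2 * x)) * (b n)^-1)).
  - by near=> n; rewrite mulr_ge0 ?powR_ge0 ?expR_ge0//= boundary_oo.
  - exact: cvg_cst.
  - by rewrite -[X in _ --> X](mulr0 (2 * expR (x * ln (2 * x)))); apply: cvgM => //; exact: cvg_cst.
have lim : I (x + 1) n - x * I x n @[n --> \oo] --> Gamma (x + 1) - x * Gamma x.
  by apply: cvgB; [exact: IE|apply: cvgM; [exact: cvg_cst|exact: IE]].
by apply/eqP; rewrite -subr_eq0; apply/eqP; exact: (cvg_unique _ lim lim0).
Unshelve. all: by end_near. Qed.

End gamma_recursion.

(** * Partial fractions *)

Section partial_fractions.
Context {F : fieldType}.
Implicit Types (t w b : F) (s : seq F).

(** Up to the factor [t], the residue at [w = - a] of the product of the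
    [1 + t / (w + b)], for [b] in [s]. *)
Definition residue t s (a : F) : F := \prod_(b <- s | b != a) (1 + t / (b - a)).

Let residue_cons t x s a : uniq (x :: s) -> a \in s ->
  residue t (x :: s) a = (1 + t / (x - a)) * residue t s a.
Proof.
move=> /= /andP[xs _] as_; rewrite /residue big_cons.
by case: eqP => // xa; rewrite xa as_ in xs.
Qed.

Let residue_head t x s : x \notin s ->
  residue t (x :: s) x = \prod_(b <- s) (1 + t / (b - x)).
Proof.
move=> xs; rewrite /residue big_cons eqxx big_seq_cond [RHS]big_seq_cond.
apply: eq_bigl => b; rewrite andbT; case: (boolP (b \in s)) => //= bs.
by apply: contraNneq xs => <-.
Qed.

(** Induction on the list: the new factor splits each old pole in two, and the
    residue at the new point is the induction hypothesis evaluated there. *)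
Lemma partial_fractions t s w : uniq s -> (forall a, a \in s -> w + a != 0) ->
  \prod_(a <- s) (1 + t / (w + a)) = 1 + \sum_(a <- s) t * residue t s a / (w + a).
Proof.
elim: s w => [|x s IH] w us ws; first by rewrite !big_nil addr0.
have /andP[xs us'] := us.
have wx : w + x != 0 by apply: ws; rewrite inE eqxx.
have ws' a : a \in s -> w + a != 0 by move=> h; apply: ws; rewrite inE h orbT.
have xa a : a \in s -> x - a != 0.
  by move=> h; rewrite subr_eq0; apply: contraNneq xs => ->.
rewrite !big_cons (IH w us' ws') residue_head//.
have -> : \prod_(b <- s) (1 + t / (b - x)) =
    1 + \sum_(a <- s) t * residue t s a / (a - x).
  rewrite (eq_bigr (fun b => 1 + t / (- x + b))); last first.
    by move=> b _; rewrite [- x + b]addrC.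
  rewrite (IH (- x) us'); last first.
    by move=> a /xa; rewrite -[x - a]opprB oppr_eq0 addrC.
  by congr (1 + _); apply: eq_bigr => a _; rewrite [- x + a]addrC.
have -> : \sum_(a <- s) t * residue t (x :: s) a / (w + a) =
    \sum_(a <- s) (t * residue t s a / (w + a) +
      t / (w + x) * (t * residue t s a / (w + a) - t * residue t s a / (a - x))).
  apply: eq_big_seq => a as_; rewrite residue_cons//.
  have h1 := ws' _ as_; have h2 := xa _ as_.
  by field; rewrite h1 wx h2 -[a - x]opprB oppr_eq0 h2.
rewrite big_split/= -mulr_sumr sumrB.
set A := \sum_(a <- s) _; set B := \sum_(a <- s) _.
by field.
Qed.

Lemma sum_residue t s : uniq s -> \sum_(a <- s) residue t s a = (size s)%:R.
Proof.
elim: s => [|x s IH] us; first by rewrite big_nil.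
have /andP[xs us'] := us.
have xa a : a \in s -> x - a != 0.
  by move=> h; rewrite subr_eq0; apply: contraNneq xs => ->.
rewrite big_cons residue_head//=.
rewrite (eq_bigr (fun b => 1 + t / (- x + b))); last first.
  by move=> b _; rewrite [- x + b]addrC.
rewrite partial_fractions//; last first.
  by move=> a /xa; rewrite -[x - a]opprB oppr_eq0 addrC.
rewrite -nat1r -(IH us') -addrA -big_split/=; congr (1 + _).
rewrite big_seq [RHS]big_seq; apply: eq_bigr => a as_.
rewrite residue_cons//; have h2 := xa _ as_.
by field; rewrite h2 -oppr_eq0 opprD opprK h2.
Qed.

Lemma linear_partial_fractions t b s w :
  uniq s -> (forall a, a \in s -> w + a != 0) ->
  (w + b) * \prod_(a <- s) (1 + t / (w + a)) =
  w + b + t * (size s)%:R + \sum_(a <- s) t * (b - a) * residue t s a / (w + a).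
Proof.
move=> us ws; rewrite partial_fractions// mulrDr mulr1 -[RHS]addrA; congr (_ + _).
rewrite -(sum_residue t us) !mulr_sumr -big_split/= big_seq [RHS]big_seq.
by apply: eq_bigr => a as_; field; exact: ws.
Qed.

End partial_fractions.

(** * Jump rates and the loop identity *)

Section pair_products.
Context {R : comPzRingType}.

(** Isolates the pairs that involve [i]: they are the only ones that a jump of
    the coordinate [i] affects. *)
Lemma prod_pairs_split N (h : 'I_N -> 'I_N -> R) (i : 'I_N) :
  \prod_(a < N) \prod_(b < N | (a < b)%N) h a b =
  (\prod_(a < N | a != i) \prod_(b < N | (a < b)%N && (b != i)) h a b) *
  \prod_(j < N | j != i) (if (j < i)%N then h j i else h i j).
Proof.
rewrite (bigD1 i)//= mulrC.
have -> : \prod_(b < N | (i < b)%N) h i b =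
    \prod_(j < N | j != i) (if (i < j)%N then h i j else 1).
  rewrite -big_mkcondr/=; apply: eq_bigl => j.
  by case: ltngtP => //=; rewrite ?andbF//; case: eqVneq => // ->; rewrite ltnn.
have row a : a != i -> \prod_(b < N | (a < b)%N) h a b =
    \prod_(b < N | (a < b)%N && (b != i)) h a b * (if (a < i)%N then h a i else 1).
  move=> ai; case: ifPn => [ai'|].
    by rewrite (bigD1 i)//= mulrC.
  rewrite -leqNgt mulr1 => ia; apply: eq_bigl => b.
  by case: (eqVneq b i) => [->|]; rewrite ?andbT// andbF ltnNge ia.
rewrite (eq_bigr _ row) big_split/= -mulrA; congr (_ * _).
rewrite -big_split/=; apply: eq_bigr => j ji.
by case: ltngtP; rewrite ?mulr1 ?mul1r// => /val_inj ij; rewrite ij eqxx in ji.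
Qed.

End pair_products.

Section interaction.
Context {R : realType}.
Variable theta : R.

(** The residue at the coordinate [i]; with the linear factor of the one-body
    weight it gives the rate of a downward ([t = theta]) or upward
    ([t = - theta]) jump of that coordinate. *)
Definition interaction (t : R) N (l : nat -> R) (i : 'I_N) : R :=
  \prod_(j < N | j != i) (1 + t / (l j - l i)).

Lemma interactionE t N (l : nat -> R) (i : 'I_N) :
  injective (fun j : 'I_N => l j) ->
  interaction t l i = residue t [seq l j | j : 'I_N <- enum 'I_N] (l i).
Proof.
move=> inj; rewrite /residue big_map big_enum_cond/=; apply: eq_bigl => j.
by have /= -> := inj_eq inj j i.
Qed.

Definition ell_max N M : R := M%:R + N%:R * theta - theta.

End interaction.

(** The Gamma function enters only through positivity and the recursion
    [G (x + 1) = x * G x], hence an arbitrary [G] with these two properties. *)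
Section gamma_quotients.
Context {R : realType}.
Variables (G : R -> R) (theta : R).
Hypothesis theta_gt0 : 0 < theta.
Hypothesis G_gt0 : forall x : R, 0 < x -> 0 < G x.
Hypothesis GS : forall x : R, 0 < x -> G (x + 1) = x * G x.

Definition pair_weight (x : R) : R := G (x + theta) * G (x + 1) / (G x * G (x + 1 - theta)).

Definition site_weight (T y : R) : R := (G (y + 1) * G (T - y + 1))^-1.

Lemma pair_balance (x : R) : theta <= x ->
  pair_weight (x + 1) * ((x + 1 - theta) * x) =
  pair_weight x * ((x + 1) * (x + theta)).
Proof.
have t0 := theta_gt0; move=> tx; rewrite /pair_weight.
have [p1 p2 p3 p4] : [/\ 0 < x + theta, 0 < x + 1, 0 < x & 0 < x + 1 - theta].
  by split; lra.
have -> : x + 1 + theta = (x + theta) + 1 by ring.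
have -> : x + 1 + 1 - theta = (x + 1 - theta) + 1 by ring.
rewrite (GS p1) (GS p2) (GS p3) (GS p4).
have := lt0r_neq0 (G_gt0 p3); have := lt0r_neq0 (G_gt0 p4).
by move=> g1 g2; field; rewrite g1 g2 !lt0r_neq0.
Qed.

Lemma pair_interaction_balance (x : R) : theta <= x ->
  pair_weight (x + 1) * (1 - theta / (x + 1)) = pair_weight x * (1 + theta / x).
Proof.
have t0 := theta_gt0; move=> tx; have pb := pair_balance tx.
have [p2 p3] : 0 < x + 1 /\ 0 < x by split; lra.
move: (lt0r_neq0 p2) (lt0r_neq0 p3) => {t0 p2 p3} x2 x1.
have -> : 1 + theta / x = (x + 1) * (x + theta) / (x * (x + 1)).
  by field; rewrite x1 x2.
have -> : 1 - theta / (x + 1) = (x + 1 - theta) * x / (x * (x + 1)).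
  by field; rewrite x1 x2.
by rewrite mulrA pb -mulrA.
Qed.

Lemma site_balance (T y : R) : 0 <= y -> y + 1 <= T ->
  site_weight T (y + 1) * (y + 1) = site_weight T y * (T - y).
Proof.
move=> y0 yT; rewrite /site_weight.
have -> : T - (y + 1) + 1 = T - y by ring.
have [p1 p2] : 0 < y + 1 /\ 0 < T - y by split; lra.
rewrite (GS p1) (GS p2).
have := lt0r_neq0 (G_gt0 p1); have := lt0r_neq0 (G_gt0 p2).
by move=> g1 g2; field; rewrite g1 g2 !lt0r_neq0.
Qed.

Definition quotient_weight N M (l : nat -> R) : R :=
  (\prod_(i < N) \prod_(j < N | (i < j)%N)
     (G (l i - l j + theta) * G (l i - l j + 1) /
      (G (l i - l j) * G (l i - l j + 1 - theta)))) *
  \prod_(i < N)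
     (G (l i + 1) * G (M%:R + N%:R * theta - l i + 1 - theta))^-1.

Lemma gamma_weight_balance N M (l l' : nat -> R) (i : 'I_N) :
  (forall j : 'I_N, j != i -> l' j = l j) -> l' i = l i - 1 ->
  (forall j : 'I_N, (j < i)%N -> theta <= l j - l i) ->
  (forall j : 'I_N, (i < j)%N -> theta <= l' i - l j) ->
  1 <= l i -> l i <= ell_max theta N M ->
  quotient_weight N M l * (l i * interaction theta l i) =
  quotient_weight N M l' * ((ell_max theta N M - l' i) * interaction (- theta) l' i).
Proof.
move=> l'j l'i lti gti li1 liT; rewrite /quotient_weight.
pose h (k : nat -> R) (a b : 'I_N) := pair_weight (k a - k b).
have split_l (k : nat -> R) : (\prod_(a < N) \prod_(b < N | (a < b)%N)
     (G (k a - k b + theta) * G (k a - k b + 1) /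
      (G (k a - k b) * G (k a - k b + 1 - theta)))) =
  (\prod_(a < N | a != i) \prod_(b < N | (a < b)%N && (b != i)) h k a b) *
  \prod_(j < N | j != i) (if (j < i)%N then h k j i else h k i j).
  exact: (prod_pairs_split (h k)).
rewrite !split_l.
have site (k : nat -> R) : \prod_(a < N)
    (G (k a + 1) * G (M%:R + N%:R * theta - k a + 1 - theta))^-1 =
  site_weight (ell_max theta N M) (k i) * \prod_(a < N | a != i) site_weight (ell_max theta N M) (k a).
  rewrite (eq_bigr (fun a : 'I_N => site_weight (ell_max theta N M) (k a))).
    by rewrite (bigD1 i).
  by move=> a _; rewrite /site_weight /ell_max; congr (_ * G _)^-1; ring.
rewrite !site.
set K := \prod_(a < N | a != i) \prod_(b < N | _ && _) h l a b.
have -> : \prod_(a < N | a != i) \prod_(b < N | (a < b)%N && (b != i)) h l' a b = K.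
  apply: eq_bigr => a ai; apply: eq_bigr => b /andP[_ bi].
  by rewrite /h !l'j.
set S := \prod_(a < N | a != i) site_weight _ (l a).
have -> : \prod_(a < N | a != i) site_weight (ell_max theta N M) (l' a) = S.
  by apply: eq_bigr => a ai; rewrite l'j.
have E1 : site_weight (ell_max theta N M) (l i) * l i =
    site_weight (ell_max theta N M) (l' i) * (ell_max theta N M - l' i).
  by rewrite -site_balance l'i; [rewrite subrK|lra|lra].
have E2 : (\prod_(j < N | j != i) (if (j < i)%N then h l j i else h l i j)) *
    interaction theta l i =
  (\prod_(j < N | j != i) (if (j < i)%N then h l' j i else h l' i j)) *
    interaction (- theta) l' i.
  rewrite /interaction -!big_split/=; apply: eq_bigr => j ji.
  have pb := pair_interaction_balance.
  rewrite /h (l'j j)// l'i.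
  case: ltngtP => [ji'|ij|/val_inj ij]; last by rewrite ij eqxx in ji.
    have -> : l j - (l i - 1) = l j - l i + 1 by ring.
    by rewrite mulNr (pb _ (lti _ ji')).
  have := pb _ (gti _ ij); rewrite l'i.
  have -> : l i - 1 - l j + 1 = l i - l j by ring.
  have -> : l j - (l i - 1) = - (l i - 1 - l j) by ring.
  have -> : l j - l i = - (l i - l j) by ring.
  by rewrite !invrN mulrNN mulrN.
rewrite -(mulrA K) (mulrC (site_weight _ (l i))) (mulrC (site_weight _ (l' i))).
set Q := \prod_(j < N | _) _ in E2 *; set Q' := \prod_(j < N | _) _ in E2 *.
transitivity (K * S * (Q * interaction theta l i) *
  (site_weight (ell_max theta N M) (l i) * l i)); first by ring.
by rewrite E1 E2; ring.
Qed.

End gamma_quotients.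

Section jump_rates.
Context {R : realType}.
Variable theta : R.
Hypothesis theta_gt0 : 0 < theta.

(** The discrete loop (Nekrasov) expression. The linear factors are those of the
    quotient of the one-body weights at two consecutive points; because they are
    linear, the polynomial part in [w] is a constant, which is subtracted. *)
Definition loop_expression N (l : nat -> R) (w T : R) : R :=
  (w + 1 + T) * \prod_(j < N) (1 - theta / (w + 1 + l j)) -
  w * \prod_(j < N) (1 + theta / (w + l j)) - (T + 1 - 2 * theta * N%:R).

(** Partial fractions of both products, at [w] and at [w + 1]. *)
Lemma loop_identity N (l : nat -> R) (w T : R) :
  injective (fun j : 'I_N => l j) ->
  (forall j : 'I_N, 0 < w + l j) ->
  loop_expression N l w T =
  \sum_(i < N) theta * l i * interaction theta l i / (w + l i) -
  \sum_(i < N) theta * (T - l i) * interaction (- theta) l i / (w + 1 + l i).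
Proof.
rewrite /loop_expression => inj wl; pose s := [seq l j | j : 'I_N <- enum 'I_N].
have us : uniq s by rewrite map_inj_uniq ?enum_uniq//.
have szs : size s = N by rewrite size_map size_enum_ord.
have ws a : a \in s -> w + a != 0 by move=> /mapP[j _ ->]; rewrite gt_eqF.
have ws1 a : a \in s -> w + 1 + a != 0.
  by move=> /mapP[j _ ->]; have := wl j => h; rewrite gt_eqF//; lra.
have sumE (f : R -> R) : \sum_(a <- s) f a = \sum_(j < N) f (l j).
  by rewrite big_map big_enum.
have prodE (f : R -> R) : \prod_(a <- s) f a = \prod_(j < N) f (l j).
  by rewrite big_map big_enum.
have := linear_partial_fractions (- theta) T us ws1.
rewrite prodE sumE szs => E2.
have := linear_partial_fractions theta 0 us ws.
rewrite prodE sumE szs addr0 => ->.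
under [X in _ * X - _ - _ = _]eq_bigr do rewrite -mulNr.
rewrite E2.
under [X in _ = X - _]eq_bigr do rewrite interactionE//.
under [X in _ = _ - X]eq_bigr do rewrite interactionE//.
set A := \sum_(j < N) _; set B := \sum_(j < N) _.
rewrite [X in _ = X - _](_ : _ = - B); last first.
  by rewrite -sumrN; apply: eq_bigr => i _; rewrite -/s; ring.
rewrite [X in _ = _ - X](_ : _ = - A); last first.
  by rewrite -sumrN; apply: eq_bigr => i _; rewrite -/s; ring.
by ring.
Qed.

Lemma weight_balance N M (l l' : nat -> R) (i : 'I_N) :
  (forall j : 'I_N, j != i -> l' j = l j) -> l' i = l i - 1 ->
  (forall j : 'I_N, (j < i)%N -> theta <= l j - l i) ->
  (forall j : 'I_N, (i < j)%N -> theta <= l' i - l j) ->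
  1 <= l i -> l i <= ell_max theta N M ->
  weight theta N M l * (l i * interaction theta l i) =
  weight theta N M l' * ((ell_max theta N M - l' i) * interaction (- theta) l' i).
Proof. exact: (gamma_weight_balance theta_gt0 (@Gamma_gt0 R) (@GammaS R)). Qed.

End jump_rates.

(** * Adding and removing a box *)

Section box_moves.
Variables N M : nat.
Implicit Types (lam mu : box_partition N M) (i j : 'I_N).

Definition part lam (i : nat) : nat := nth 0%N [seq val k | k <- val lam] i.

Lemma part_leM lam i : (part lam i <= M)%N.
Proof.
by rewrite /part (nth_map ord0) ?size_tuple// -ltnS ltn_ord.
Qed.

Lemma part_mono lam i j : (i <= j)%N -> (part lam j <= part lam i)%N.
Proof.
move=> ij; have tr : transitive geq by move=> a b c ba cb; exact: leq_trans cb ba.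
by apply: (sorted_leq_nth tr leqnn 0%N (svalP lam)) ij; rewrite inE size_map size_tuple.
Qed.

Lemma part_inj lam mu : (forall i, part lam i = part mu i) -> lam = mu.
Proof.
move=> h; apply/val_inj/eq_from_tnth => i; apply/val_inj => /=.
have := h i; rewrite /part !(nth_map ord0) ?size_tuple//.
by rewrite !(tnth_nth ord0).
Qed.

(** Meaningful for nonincreasing [p] bounded by [M]. *)
Definition of_parts (p : 'I_N -> nat) : box_partition N M :=
  let: lam := insub [tuple inord (p i) | i < N] :
    option {lam : N.-tuple 'I_M.+1 | sorted geq [seq val k | k <- lam]} in
  if lam is Some mu then mu else point.

Lemma of_partsE p : (forall i j, (i <= j)%N -> (p j <= p i)%N) ->
  (forall i, (p i <= M)%N) -> forall i, part (of_parts p) i = p i.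
Proof.
move=> pmono pM; pose t : N.-tuple 'I_M.+1 := [tuple inord (p i) | i < N].
have tE i : nth 0%N [seq val k | k <- t] i = p i.
  rewrite (nth_map ord0) ?size_tuple//.
  by rewrite -tnth_nth tnth_mktuple/= inordK// ltnS.
have st : sorted geq [seq val k | k <- t].
  apply/(sortedP 0%N) => i; rewrite size_map size_tuple => iN.
  have i'N : (i < N)%N by exact: ltn_trans iN.
  by rewrite /= (tE (Ordinal iN)) (tE (Ordinal i'N)); apply: pmono => /=.
by move=> i; rewrite /of_parts insubT/= /part /=.
Qed.

Definition can_down lam i :=
  (0 < part lam i)%N && [forall j : 'I_N, (i < j)%N ==> (part lam j < part lam i)%N].

Definition can_up lam i :=
  (part lam i < M)%N && [forall j : 'I_N, (j < i)%N ==> (part lam i < part lam j)%N].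

Definition down i lam := of_parts (fun j => part lam j - (j == i))%N.

Definition up i lam := of_parts (fun j => part lam j + (j == i))%N.

Lemma part_down lam i j : can_down lam i ->
  part (down i lam) j = (part lam j - (j == i))%N.
Proof.
move=> /andP[i0 /forallP h]; apply: of_partsE => [a b ab|a]; last first.
  by rewrite (leq_trans (leq_subr _ _))// part_leM.
have := part_mono lam ab; case: (eqVneq a i) => [ai|_] /=; last by case: eqP; lia.
case: (eqVneq b i) => [bi|bi]; first lia.
have {}ab : (i < b)%N.
  by rewrite ltn_neqAle -ai ab andbT; apply: contraNneq bi => /val_inj <-; rewrite ai.
have /implyP/(_ ab) := h b; rewrite ai; lia.
Qed.

Lemma part_up lam i j : can_up lam i ->
  part (up i lam) j = (part lam j + (j == i))%N.
Proof.
move=> /andP[iM /forallP h]; apply: of_partsE => [a b ab|a]; last first.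
  by have := part_leM lam a; case: (eqVneq a i) => [->|]; lia.
have := part_mono lam ab; case: (eqVneq b i) => [bi|_] /=; last by case: eqP; lia.
case: (eqVneq a i) => [ai|ai]; first lia.
have {}ab : (a < i)%N.
  by rewrite ltn_neqAle -bi ab andbT; apply: contraNneq ai => /val_inj ->; rewrite bi.
have /implyP/(_ ab) := h a; rewrite bi; lia.
Qed.

Lemma can_up_down lam i : can_down lam i -> can_up (down i lam) i.
Proof.
move=> cd; rewrite /can_up part_down// eqxx.
have /andP[i0 _] := cd; have := part_leM lam i => iM.
apply/andP; split; first lia.
apply/forallP => j; apply/implyP => ji; rewrite part_down//.
have := part_mono lam (ltnW ji).
by case: (eqVneq j i) => [jE|]; [rewrite jE ltnn in ji|lia].
Qed.

Lemma can_down_up lam i : can_up lam i -> can_down (up i lam) i.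
Proof.
move=> cu; rewrite /can_down part_up// eqxx addn1/=.
apply/forallP => j; apply/implyP => ij; rewrite part_up//.
have := part_mono lam (ltnW ij).
by case: (eqVneq j i) => [jE|]; [rewrite jE ltnn in ij|lia].
Qed.

Lemma downK lam i : can_down lam i -> up i (down i lam) = lam.
Proof.
move=> cd; apply: part_inj => j; rewrite part_up ?can_up_down// part_down//.
by have /andP[i0 _] := cd; case: (eqVneq j i) => [->|]; lia.
Qed.

Lemma upK lam i : can_up lam i -> down i (up i lam) = lam.
Proof.
move=> cu; apply: part_inj => j; rewrite part_down ?can_down_up// part_up//; lia.
Qed.

(** The jumps up are the reversed jumps down. *)
Lemma sum_can_up (V : nmodType) i (F : box_partition N M -> V) :
  \sum_(lam | can_up lam i) F lam = \sum_(lam | can_down lam i) F (down i lam).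
Proof.
rewrite (reindex_onto (down i) (up i)); last by move=> lam; exact: upK.
apply: eq_bigl => lam; apply/andP/idP => [[cu /eqP <-]|cd].
  exact: can_down_up.
by rewrite can_up_down// downK.
Qed.

Lemma not_can_down lam i (i1 : (i.+1 < N)%N) : ~~ can_down lam i ->
  part lam i.+1 = part lam i.
Proof.
have mono := part_mono lam (leqnSn i : (i <= Ordinal i1)%N).
rewrite negb_and -leqNgt => /orP[|/forallPn[j]]; first by move: mono => /=; lia.
rewrite negb_imply -leqNgt => /andP[ij].
have := part_mono lam (ij : (Ordinal i1 <= j)%N).
by move: mono => /=; lia.
Qed.

Lemma not_can_up lam i (i1 : (0 < i)%N) : ~~ can_up lam i ->
  part lam i.-1 = part lam i.
Proof.
have iN : (i.-1 < N)%N by have := ltn_ord i; lia.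
have mono := part_mono lam (leq_pred i : (Ordinal iN <= i)%N).
have M1 := part_leM lam (Ordinal iN).
rewrite negb_and -leqNgt => /orP[|/forallPn[j]]; first by move: mono M1 => /=; lia.
rewrite negb_imply -leqNgt => /andP[ji].
have ji' : (j <= Ordinal iN)%N by rewrite /=; lia.
have := part_mono lam ji'.
by move: mono => /=; lia.
Qed.

End box_moves.

(** * The reversible jump process *)

Section reversible_dynamics.
Context {R : realType}.
Variable theta : R.
Hypothesis theta_gt0 : 0 < theta.
Variables N M : nat.
Implicit Types (lam mu : box_partition N M) (i j : 'I_N).

Local Notation l := (ell theta).
Local Notation T := (ell_max theta N M).

Definition down_rate lam i : R := theta * l lam i * interaction theta (l lam) i.

Definition up_rate lam i : R :=
  theta * (T - l lam i) * interaction (- theta) (l lam) i.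

Lemma ellE lam (i : nat) : l lam i = (part lam i)%:R + (N - i.+1)%:R * theta.
Proof. by []. Qed.

Lemma ell_gap lam i j : (i < j)%N -> theta <= l lam i - l lam j.
Proof.
move=> ij; have /(ell_diff theta_gt0 lam) : (i < j < N)%N by rewrite ij ltn_ord.
by apply: le_trans; rewrite ler_peMl ?(ltW theta_gt0)// ler1n subn_gt0.
Qed.

Lemma ell_inj lam : injective (fun j : 'I_N => l lam j).
Proof.
move=> i j /= e; apply/val_inj; case: (ltngtP i j) => // /(ell_gap lam).
  by rewrite e subrr leNgt theta_gt0.
by rewrite e subrr leNgt theta_gt0.
Qed.

Lemma ell_le_top lam i : l lam i <= T.
Proof. by have := ell_le theta_gt0 lam (ltn_ord i); rewrite /ell_max mulrBl mul1r addrA. Qed.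

(** Distinct coordinates differ by at least [theta], so every factor is a
    nonnegative number; this sign is what makes the rates of a Markov chain out
    of the residues. *)
Lemma interaction_ge0 lam i : 0 <= interaction theta (l lam) i.
Proof.
apply: prodr_ge0 => j ji; case: (ltngtP j i) => [|ij|/val_inj e].
- move=> /(ell_gap lam) h; have d0 := lt_le_trans theta_gt0 h.
  by rewrite addr_ge0// divr_ge0// ltW.
- have h := ell_gap lam ij; have d0 := lt_le_trans theta_gt0 h.
  by rewrite -opprB invrN mulrN subr_ge0 ler_pdivrMr// mul1r.
- by rewrite e eqxx in ji.
Qed.

Lemma down_rate_ge0 lam i : 0 <= down_rate lam i.
Proof.
by rewrite /down_rate !mulr_ge0 ?interaction_ge0 ?ell_ge0// ltW.
Qed.

(** The residues sum to [N], by the same partial fractions, which bounds the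
    total rate by a multiple of [N ^+ 2]. *)
Lemma sum_down_rate_le lam : \sum_(i < N) down_rate lam i <= theta * T * N%:R.
Proof.
apply: (@le_trans _ _ (\sum_(i < N) theta * T * interaction theta (l lam) i)).
  apply: ler_sum => i _; rewrite /down_rate ler_wpM2r ?interaction_ge0//.
  by rewrite ler_wpM2l ?(ltW theta_gt0)// ell_le_top.
rewrite -mulr_sumr; suff -> : \sum_(i < N) interaction theta (l lam) i = N%:R by [].
pose s := [seq l lam j | j : 'I_N <- enum 'I_N].
have us : uniq s by rewrite map_inj_uniq ?enum_uniq//; exact: ell_inj.
have := sum_residue theta us; rewrite size_map size_enum_ord => <-.
rewrite big_map big_enum/=; apply: eq_bigr => i _.
by rewrite interactionE//; exact: ell_inj.
Qed.

(** A forbidden jump has rate zero: the coordinate is at distance exactly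
    [theta] from its neighbour, or it is the last one and equals [0]. *)
Lemma down_rate0 lam i : ~~ can_down lam i -> down_rate lam i = 0.
Proof.
move=> cd; rewrite /down_rate; case: (ltnP i.+1 N) => i1.
  have e := not_can_down i1 cd.
  rewrite /interaction (bigD1 (Ordinal i1))/=; last first.
    by apply/eqP => /(congr1 val)/=; lia.
  have -> : l lam i.+1 - l lam i = - theta.
    have E : (N - i.+1 = (N - i.+2).+1)%N by lia.
    by rewrite !ellE e [in X in _ - X]E -natr1; ring.
  by rewrite invrN mulrN divff ?gt_eqF// subrr mul0r mulr0.
have iN : i.+1 = N by have := ltn_ord i; lia.
move: cd; rewrite negb_and => /orP[|/forallPn[j]]; last first.
  by rewrite negb_imply; have := ltn_ord j; lia.
rewrite -eqn0Ngt => /eqP p0.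
by rewrite ellE p0 iN subnn mul0r addr0 mulr0 mul0r.
Qed.

Lemma up_rate0 lam i : ~~ can_up lam i -> up_rate lam i = 0.
Proof.
move=> cu; rewrite /up_rate; case: (posnP i) => i1; last first.
  have e := not_can_up i1 cu.
  have iN : (i.-1 < N)%N by have := ltn_ord i; lia.
  rewrite /interaction (bigD1 (Ordinal iN))/=; last first.
    by apply/eqP => /(congr1 val)/=; lia.
  have -> : l lam i.-1 - l lam i = theta.
    have E : (N - i.-1.+1 = (N - i.+1).+1)%N by have := ltn_ord i; lia.
    by rewrite !ellE e E -natr1; ring.
  by rewrite mulNr divff ?gt_eqF// subrr mul0r mulr0.
move: cu; rewrite negb_and => /orP[|/forallPn[j]]; last first.
  by rewrite negb_imply; lia.
rewrite -leqNgt => p0.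
have pM : part lam i = M by apply/eqP; rewrite eqn_leq p0 part_leM.
rewrite ellE pM i1 subn1 /ell_max.
have -> : N%:R = N.-1%:R + 1 :> R by rewrite natr1 prednK//; exact: (leq_ltn_trans _ (ltn_ord i)).
by rewrite (_ : _ - _ = 0) ?mulr0 ?mul0r//; ring.
Qed.

Lemma ell_down lam i j : can_down lam i ->
  l (down i lam) j = l lam j - (j == i)%:R.
Proof.
move=> cd; rewrite !ellE part_down// natrB; first by ring.
by have /andP[i0 _] := cd; case: eqP => // ->.
Qed.

Lemma detailed_balance lam i : can_down lam i ->
  ensemble_pmf theta lam * down_rate lam i =
  ensemble_pmf theta (down i lam) * up_rate (down i lam) i.
Proof.
move=> cd; rewrite /ensemble_pmf /down_rate /up_rate.
set Z := partition_function _ _ _.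
have := @weight_balance R theta theta_gt0 N M (l lam) (l (down i lam)) i.
move: (weight theta N M (l lam)) (weight theta N M (l (down i lam))) => W W' WB.
have {}WB : W * (l lam i * interaction theta (l lam) i) =
    W' * ((T - l (down i lam) i) * interaction (- theta) (l (down i lam)) i).
  apply: WB.
  - by move=> j /negPf ji; rewrite ell_down// ji subr0.
  - by rewrite ell_down// eqxx.
  - by move=> j ji; exact: ell_gap.
  - move=> j ij; have := ell_gap (down i lam) ij.
    by rewrite [l _ j]ell_down// (gtn_eqF ij : (j == i) = false) subr0.
  - rewrite ellE; have /andP[i0 _] := cd.
    by rewrite (@le_trans _ _ (part lam i)%:R) ?ler1n// lerDl mulr_ge0// ltW.
  - exact: ell_le_top.
transitivity (theta / Z * (W * (l lam i * interaction theta (l lam) i))).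
  by ring.
by rewrite WB; ring.
Qed.

(** Summation by parts for the jump process: detailed balance turns the sum over
    the jumps up into a sum over the jumps down, in which only the increment of
    the observable [F] survives. *)
Lemma reversibility (w : R) (F : box_partition N M -> R) :
  \sum_lam ensemble_pmf theta lam *
    ((\sum_(i < N) down_rate lam i / (w + l lam i) -
      \sum_(i < N) up_rate lam i / (w + 1 + l lam i)) * F lam) =
  \sum_lam ensemble_pmf theta lam * \sum_(i < N | can_down lam i)
     down_rate lam i / (w + l lam i) * (F lam - F (down i lam)).
Proof.
have db : forall lam i, can_down lam i -> ensemble_pmf theta lam * down_rate lam i =
    ensemble_pmf theta (down i lam) * up_rate (down i lam) i.
  exact: detailed_balance.
move: (@ensemble_pmf R theta N M) db => p db.
under eq_bigr do rewrite mulrBl mulrBr !mulr_suml.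
rewrite sumrB.
have -> : \sum_lam p lam *
    (\sum_(i < N) up_rate lam i / (w + 1 + l lam i) * F lam) =
  \sum_lam p lam * \sum_(i < N | can_down lam i)
     down_rate lam i / (w + l lam i) * F (down i lam).
  under eq_bigr do rewrite mulr_sumr.
  under [RHS]eq_bigr do rewrite mulr_sumr.
  rewrite exchange_big/= [RHS](exchange_big_dep predT)//=.
  apply: eq_bigr => i _.
  rewrite (bigID (fun lam => can_up lam i))/= [X in _ + X]big1 ?addr0; last first.
    by move=> lam /up_rate0 ->; rewrite !mul0r mulr0.
  rewrite sum_can_up; apply: eq_bigr => lam cd.
  rewrite mulrA [p _ * _]mulrA -db// ell_down// eqxx -[true%:R]/(1 : R) !mulrA.
  by congr (_ * _ / _ * _); ring.
rewrite -sumrB; apply: eq_bigr => lam _; rewrite -mulrBr; congr (_ * _).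
rewrite (bigID (can_down lam))/= [X in _ + X - _]big1 ?addr0; last first.
  by move=> i /down_rate0 ->; rewrite !mul0r.
by rewrite -sumrB; apply: eq_bigr => i _; rewrite mulrBr.
Qed.

End reversible_dynamics.

(** * From products to exponentials *)

Section product_exponential.
Context {R : realType}.

Lemma prod_1sub_ge (I : Type) (r : seq I) (x : I -> R) :
  (forall i, 0 <= x i <= 1) ->
  1 - \sum_(i <- r) x i <= \prod_(i <- r) (1 - x i) <= 1.
Proof.
move=> x01; elim: r => [|i r IH]; first by rewrite !big_nil subr0 lexx.
rewrite !big_cons; have /andP[x0 x1] := x01 i; move: IH => /andP[].
have : 0 <= \sum_(j <- r) x j by apply: sumr_ge0 => j _; have /andP[] := x01 j.
have : 0 <= \prod_(j <- r) (1 - x j).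
  by apply: prodr_ge0 => j _; rewrite subr_ge0; have /andP[] := x01 j.
move: (\sum_(j <- r) _) (\prod_(j <- r) _) => s p p0 s0 h1 h2.
by apply/andP; split; nra.
Qed.

Lemma expR_sum_seq (I : Type) (r : seq I) (x : I -> R) :
  expR (\sum_(i <- r) x i) = \prod_(i <- r) expR (x i).
Proof. by elim/big_rec2: _ => [|i y1 y2 _ <-]; rewrite ?expR0// expRD. Qed.

(** Both bounds come from [1 + y <= expR y], at [y = v] and at [y = - v]. *)
Lemma prod_1add_expR (I : Type) (r : seq I) (v : I -> R) :
  (forall i, -1 <= v i <= 1) ->
  expR (\sum_(i <- r) v i) * (1 - \sum_(i <- r) v i ^+ 2) <=
  \prod_(i <- r) (1 + v i) <= expR (\sum_(i <- r) v i).
Proof.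
move=> v01; rewrite expR_sum_seq; apply/andP; split; last first.
  apply: ler_prod => i _; rewrite expR_ge1Dx andbT.
  by have /andP[] := v01 i; lra.
have v2 i : 0 <= v i ^+ 2 <= 1.
  by have /andP[v0 v1] := v01 i; rewrite sqr_ge0/=; nra.
have /andP[h _] := prod_1sub_ge r v2.
apply: (@le_trans _ _ (\prod_(i <- r) expR (v i) * \prod_(i <- r) (1 - v i ^+ 2))).
  by rewrite ler_wpM2l//; apply: prodr_ge0 => i _; exact: expR_ge0.
rewrite -big_split/=; apply: ler_prod => i _.
have /andP[v0 v1] := v01 i; have /andP[_ w1] := v2 i.
rewrite mulr_ge0 ?expR_ge0 ?subr_ge0//=.
have h1 : expR (v i) * (1 - v i) <= 1.
  have := ler_wpM2l (expR_ge0 (v i)) (expR_ge1Dx (- v i)).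
  by rewrite expRxMexpNx_1.
rewrite (_ : _ * _ = expR (v i) * (1 - v i) * (1 + v i)); last by ring.
by rewrite ler_piMl//; lra.
Qed.

Lemma prod_1add_expR_dist (I : Type) (r : seq I) (v : I -> R) :
  (forall i, -1 <= v i <= 1) ->
  `|\prod_(i <- r) (1 + v i) - expR (\sum_(i <- r) v i)| <=
  expR (\sum_(i <- r) v i) * \sum_(i <- r) v i ^+ 2.
Proof.
move=> v01; have /andP[] := prod_1add_expR r v01.
by rewrite mulrBr mulr1 => h1 h2; rewrite ler_norml; apply/andP; split; lra.
Qed.

Lemma ler_expR_dist (x y : R) : x <= y -> y <= 0 -> expR y - expR x <= y - x.
Proof.
move=> xy y0; have -> : expR x = expR y * expR (x - y) by rewrite -expRD addrC subrK.
rewrite -[X in X - _]mulr1 -mulrBr.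
have h := expR_ge1Dx (x - y).
have e1 : expR y <= 1 by rewrite -expR0 ler_expR.
have e2 : expR (x - y) <= 1 by rewrite -expR0 ler_expR subr_le0.
apply: (@le_trans _ _ (1 - expR (x - y))); last by lra.
by rewrite ler_piMl// subr_ge0.
Qed.

End product_exponential.

Section stieltjes_equation.
Context {R : realType}.
Variables theta M s : R.
Hypotheses (theta_gt0 : 0 < theta) (M_gt0 : 0 < M) (s_gt0 : 0 < s).

(** The limit of the loop expression divided by [N] in terms of the Stieltjes
    transform [x]: the products become exponentials. *)
Definition loop_function (x : R) : R :=
  (s + M + theta) * expR (- theta * x) - s * expR (theta * x) - (M - theta).

Let expR_gap (x y : R) : 0 <= y -> y <= x -> x - y <= expR x - expR y.
Proof.
move=> y0 yx; have -> : expR x = expR y * expR (x - y) by rewrite -expRD addrC subrK.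
have h := expR_ge1Dx (x - y).
have e1 : 1 <= expR y by rewrite -expR0 ler_expR.
rewrite -[X in _ <= _ - X]mulr1 -mulrBr (@le_trans _ _ (expR (x - y) - 1))//; first by lra.
by rewrite ler_peMl//; lra.
Qed.

Let expR_gap_sq (x y : R) : 0 <= x -> 0 <= y ->
  theta * (x - y) ^+ 2 <= (expR (theta * x) - expR (theta * y)) * (x - y).
Proof.
move=> x0 y0; have tx : 0 <= theta * x by rewrite mulr_ge0// ltW.
have ty : 0 <= theta * y by rewrite mulr_ge0// ltW.
rewrite expr2 mulrA (mulrBr theta).
have [yx|/ltW xy] := leP y x.
  by rewrite ler_wpM2r ?subr_ge0// expR_gap// ler_pM2l.
by rewrite ler_wnM2r ?subr_le0// -lerN2 !opprB expR_gap// ler_pM2l.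
Qed.

Let expRN_mono (x y : R) :
  0 <= (expR (- theta * y) - expR (- theta * x)) * (x - y).
Proof.
rewrite !mulNr; have [yx|/ltW xy] := leP y x.
  by rewrite mulr_ge0 ?subr_ge0// ler_expR lerN2 ler_pM2l.
by rewrite mulr_le0 ?subr_le0// ler_expR lerN2 ler_pM2l.
Qed.

(** The loop function decreases at rate at least [s * theta] on the half-line,
    so that its value at [x] controls the distance from [x] to the root. *)
Lemma loop_function_coercive (x y : R) : 0 <= x -> 0 <= y -> loop_function y = 0 ->
  s * theta * (x - y) ^+ 2 <= - loop_function x * (x - y).
Proof.
move=> x0 y0 hy; have h1 := expR_gap_sq x0 y0; have h2 := expRN_mono x y.
have {h1} := ler_wpM2l (ltW s_gt0) h1; rewrite mulrA => /le_trans; apply.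
have b0 : 0 <= s + M + theta by rewrite !addr_ge0// ltW.
have {}h2 := mulr_ge0 b0 h2.
have -> : - loop_function x * (x - y) = (loop_function y - loop_function x) * (x - y).
  by rewrite hy sub0r.
rewrite /loop_function; move: h2.
move: (expR _) (expR _) (expR _) (expR _) => e1 e2 e3 e4; lra.
Qed.

End stieltjes_equation.

Section loop_expression_limit.
Context {R : realType}.
Variables theta M s : R.
Hypotheses (theta_gt0 : 0 < theta) (M_gt0 : 0 < M) (s_gt0 : 0 < s).

Local Notation psi := (loop_function theta M s).

(** Each quotient [theta / (w + l j)] is [O(1/N)], so each product is the
    exponential of the sum of its quotients up to the sum of their squares,
    which is [O(1/N)] again; the shift of [w] by [1] and the rounding [m] of
    [M * N] cost as much. *)
Lemma loop_expression_dist (N : nat) (m : R) (l : nat -> R) :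
  (0 < N)%N -> theta <= s * N%:R -> `|m - M * N%:R| <= 1 ->
  (forall i : 'I_N, 0 <= l i) ->
  `|loop_expression theta N l (s * N%:R) (m + N%:R * theta - theta) / N%:R
    - psi (\sum_(i < N) (s * N%:R + l i)^-1)| <=
  ((2 + theta) + (s + M + theta) * ((theta ^+ 2 + theta) / s ^+ 2) +
    s * (expR (theta / s) * (theta / s) ^+ 2)) / N%:R.
Proof.
set n := N%:R => N0 tw mM l0.
pose w := s * n; pose T := m + n * theta - theta.
rewrite -/w -/T; set x := \sum_(i < N) _.
have n0 : 0 < n by rewrite ltr0n.
have w0 : 0 < w by rewrite mulr_gt0.
have s0 := s_gt0; have t0 := theta_gt0; have m0 := M_gt0.
have sN : s != 0 by rewrite gt_eqF.
have nN : n != 0 by rewrite gt_eqF.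
have inv_le (y : R) : 0 <= y -> 0 < (w + y)^-1 <= w^-1.
  by move=> y0; rewrite invr_gt0 lef_pV2 ?posrE ?ltr_wpDr//= lerDl y0.
have l1 (i : 'I_N) : 0 <= 1 + l i by rewrite addr_ge0.
have tw1 : theta / w <= 1 by rewrite ler_pdivrMr// mul1r.
have u01 (y : R) : 0 <= y -> 0 <= theta / (w + y) <= theta / w.
  move=> /inv_le /andP[/ltW h1 h2]; rewrite mulr_ge0 ?(ltW t0)//=.
  by rewrite ler_wpM2l// ltW.
have sq_sum (y : 'I_N -> R) : (forall i, 0 <= y i) ->
    \sum_(i < N) (theta / (w + y i)) ^+ 2 <= (theta / s) ^+ 2 / n.
  move=> y0; apply: (@le_trans _ _ (\sum_(i < N) (theta / w) ^+ 2)).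
    apply: ler_sum => i _; have /andP[h1 h2] := u01 _ (y0 i).
    by rewrite lerXn2r// nnegrE (le_trans h1).
  rewrite sumr_const card_ord -[X in X <= _]mulr_natr -/n /w le_eqVlt; apply/orP; left.
  by apply/eqP; field; rewrite sN nN.
have x0 : 0 <= x by apply: sumr_ge0 => i _; have /andP[/ltW] := inv_le _ (l0 i).
have xs : x <= s^-1.
  apply: (@le_trans _ _ (\sum_(i < N) w^-1)).
    by apply: ler_sum => i _; have /andP[] := inv_le _ (l0 i).
  rewrite sumr_const card_ord -[X in X <= _]mulr_natr -/n /w le_eqVlt; apply/orP; left.
  by apply/eqP; field; rewrite sN nN.
set A := \prod_(j < N) (1 + theta / (w + l j)).
set B := \prod_(j < N) (1 - theta / (w + 1 + l j)).
have hA : `|A - expR (theta * x)| <= expR (theta / s) * (theta / s) ^+ 2 / n.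
  have := @prod_1add_expR_dist _ _ (index_enum 'I_N) (fun j => theta / (w + l j)).
  rewrite -mulr_sumr -/x -/A => h.
  apply: le_trans (h _) _ => [i|].
    by have /andP[h1 h2] := u01 _ (l0 i); apply/andP; split; lra.
  rewrite -mulrA; apply: ler_pM; rewrite ?expR_ge0//.
  - by apply: sumr_ge0 => i _; exact: sqr_ge0.
  - by rewrite ler_expR ler_pM2l.
  - exact: sq_sum.
(* the sum that belongs to the second product, taken at w + 1 *)
pose x' : R := \sum_(i < N) (w + (1 + l i))^-1.
have x'x : 0 <= x - x' <= (s ^+ 2)^-1 / n.
  rewrite /x /x' -sumrB; apply/andP; split.
    apply: sumr_ge0 => i _; rewrite subr_ge0 lef_pV2 ?posrE ?ltr_wpDr//.
    by rewrite lerD2l lerDr.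
  apply: (@le_trans _ _ (\sum_(i < N) (w^-1 * w^-1))).
    apply: ler_sum => i _.
    have /andP[a1 a2] := inv_le _ (l0 i); have /andP[b1 b2] := inv_le _ (l1 i).
    have -> : (w + l i)^-1 - (w + (1 + l i))^-1 = (w + l i)^-1 * (w + (1 + l i))^-1.
      field; move: a1 b1; rewrite !invr_gt0 => a1 b1.
      by rewrite !gt_eqF//; lra.
    by apply: ler_pM => //; exact: ltW.
  rewrite sumr_const card_ord -[X in X <= _]mulr_natr -/n /w le_eqVlt; apply/orP; left.
  by apply/eqP; field; rewrite sN nN.
have x'0 : 0 <= x' by apply: sumr_ge0 => i _; have /andP[/ltW] := inv_le _ (l1 i).
have BE : B = \prod_(j < N) (1 + - (theta / (w + (1 + l j)))).
  by apply: eq_bigr => j _; rewrite addrA.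
have B01 : 0 <= B <= 1.
  rewrite BE; apply/andP; split.
    apply: prodr_ge0 => i _; have /andP[h1 h2] := u01 _ (l1 i); lra.
  by apply: prodr_ile1 => i _; have /andP[h1 h2] := u01 _ (l1 i); apply/andP; split; lra.
have hB : `|B - expR (- theta * x)| <= (theta ^+ 2 + theta) / s ^+ 2 / n.
  have := @prod_1add_expR_dist _ _ (index_enum 'I_N) (fun j => - (theta / (w + (1 + l j)))).
  rewrite sumrN -mulr_sumr -/x' -BE -mulNr.
  rewrite (eq_bigr (fun j : 'I_N => (theta / (w + (1 + l j))) ^+ 2)) => [h|j _]; last exact: sqrrN.
  have {h} h1 : `|B - expR (- theta * x')| <= (theta / s) ^+ 2 / n.
    apply: le_trans (h _) _ => [i|].
      by have /andP[h1 h2] := u01 _ (l1 i); apply/andP; split; lra.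
    rewrite -[leRHS]mul1r; apply: ler_pM; rewrite ?expR_ge0//.
    - by apply: sumr_ge0 => i _; exact: sqr_ge0.
    - by rewrite -expR0 ler_expR mulNr oppr_le0 mulr_ge0// ltW.
    - exact: sq_sum.
  have h2 : `|expR (- theta * x') - expR (- theta * x)| <= theta * ((s ^+ 2)^-1 / n).
    have /andP[d0 d1] := x'x.
    have le1 : - theta * x <= - theta * x' by rewrite !mulNr lerN2 ler_pM2l//; lra.
    have le2 : - theta * x' <= 0 by rewrite mulNr oppr_le0 mulr_ge0// ltW.
    rewrite ger0_norm; last by rewrite subr_ge0 ler_expR.
    apply: le_trans (ler_expR_dist le1 le2) _.
    rewrite (_ : _ - _ = theta * (x - x')); last by ring.
    by rewrite ler_pM2l.
  have -> : (theta ^+ 2 + theta) / s ^+ 2 / n =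
      (theta / s) ^+ 2 / n + theta * ((s ^+ 2)^-1 / n) by field; rewrite sN nN.
  by rewrite (le_trans _ (lerD h1 h2))// (le_trans _ (ler_normD _ _))// addrA subrK.
have -> : loop_expression theta N l w T / n - psi x =
    (m - M * n + 1 - theta) / n * (B - 1) +
    (s + M + theta) * (B - expR (- theta * x)) - s * (A - expR (theta * x)).
  rewrite /loop_expression /loop_function -/A -/B -/n /T /w.
  by move: (expR _) (expR _) => e1 e2; field; exact: nN.
rewrite [leRHS]mulrDl [X in _ <= X + _]mulrDl.
apply: le_trans (ler_normB _ _) _; apply: lerD; last first.
  by rewrite normrM (gtr0_norm s0) -mulrA ler_pM2l.
apply: le_trans (ler_normD _ _) _; apply: lerD; last first.
  have b0 : 0 < s + M + theta by lra.
  by rewrite normrM (gtr0_norm b0) -mulrA ler_pM2l.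
rewrite normrM normrM normfV (gtr0_norm n0) mulrAC ler_pM2r ?invr_gt0//.
have hB1 : `|B - 1| <= 1 by move: B01 => /andP[? ?]; rewrite ler_norml; apply/andP; split; lra.
have hd : `|m - M * n + 1 - theta| <= 2 + theta.
  by move: mM; rewrite !ler_norml => /andP[? ?]; apply/andP; split; lra.
by rewrite -[leRHS]mulr1; apply: ler_pM.
Qed.

End loop_expression_limit.

(** * Mean square convergence of the Stieltjes transform *)

Section mean_square.
Context {R : realType}.
Variables theta M s : R.
Hypotheses (theta_gt0 : 0 < theta) (M_gt0 : 0 < M) (s_gt0 : 0 < s).

Local Notation psi := (loop_function theta M s).

(** With [w = s * N] this is the Stieltjes transform of the empirical measure
    at [- s], up to the sign. *)
Definition resolvent_sum (w : R) N K (lam : box_partition N K) : R :=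
  \sum_(i < N) (w + ell theta lam i)^-1.

Lemma resolvent_sum_down (w : R) N K (lam : box_partition N K) (i : 'I_N) :
  0 < w -> can_down lam i ->
  - (w ^+ 2)^-1 <= resolvent_sum w lam - resolvent_sum w (down i lam) <= 0.
Proof.
move=> w0 cd; rewrite /resolvent_sum -sumrB (bigD1 i)//= big1 ?addr0; last first.
  by move=> j /negPf ji; rewrite ell_down// ji subr0 subrr.
rewrite ell_down// eqxx -[true%:R]/(1 : R).
have l1 : 1 <= ell theta lam i.
  rewrite ellE; have /andP[i0 _] := cd.
  by rewrite (@le_trans _ _ (part lam i)%:R) ?ler1n// lerDl mulr_ge0// ltW.
move: (ell theta lam i) l1 => y y1.
have a0 : 0 < w + y by lra.
have b0 : 0 < w + (y - 1) by lra.
have -> : (w + y)^-1 - (w + (y - 1))^-1 = - ((w + y) * (w + (y - 1)))^-1.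
  by field; rewrite !lt0r_neq0.
rewrite lerN2 oppr_le0 invr_ge0 mulr_ge0 ?(ltW a0) ?(ltW b0)// andbT.
rewrite lef_pV2 ?posrE ?mulr_gt0 ?exprn_gt0// expr2.
by apply: ler_pM; lra.
Qed.

(** A jump changes the resolvent sum by at most [w ^- 2], each pole contributes
    at most [w ^-1], and the total rate is at most [theta * ell_max * N]: with
    [w] of order [N] the correlation is [O(1/N)], although the loop expression
    is of order [N]. *)
Lemma mean_loop_ge (w S : R) N K : 0 < w ->
  - (theta * ell_max theta N K * N%:R / w ^+ 3) <=
  \sum_(lam : box_partition N K) ensemble_pmf theta lam *
    (loop_expression theta N (ell theta lam) w (ell_max theta N K) *
     (resolvent_sum w lam - S)).
Proof.
move=> w0.
have p0 (lam : box_partition N K) : 0 <= ensemble_pmf theta lam.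
  by rewrite ltW// ensemble_pmf_gt0.
have p1 := ensemble_pmf_sum1 theta_gt0 N K.
under eq_bigr => lam _.
  rewrite loop_identity; last 2 first.
  - exact: ell_inj.
  - by move=> j; rewrite ltr_wpDr// ell_ge0.
  over.
have := reversibility theta_gt0 w (fun lam : box_partition N K => resolvent_sum w lam - S).
rewrite /= => ->.
move: (@ensemble_pmf R theta N K) p0 p1 => p p0 p1.
have -> : - (theta * ell_max theta N K * N%:R / w ^+ 3) =
    \sum_lam p lam * - (theta * ell_max theta N K * N%:R / w ^+ 3).
  by rewrite -mulr_suml p1 mul1r.
apply: ler_sum => lam _; rewrite ler_wpM2l//.
apply: (@le_trans _ _ (\sum_(i < N | can_down lam i)
    - (down_rate theta lam i / w ^+ 3))); last first.
  apply: ler_sum => i cd.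
  have -> : resolvent_sum w lam - S - (resolvent_sum w (down i lam) - S) =
    resolvent_sum w lam - resolvent_sum w (down i lam) by ring.
  have /andP[] := resolvent_sum_down w0 cd.
  have d0 := down_rate_ge0 theta_gt0 lam i.
  have wl : 0 < w + ell theta lam i by rewrite ltr_wpDr// ell_ge0.
  have wi : (w + ell theta lam i)^-1 <= w^-1.
    by rewrite lef_pV2 ?posrE// lerDl ell_ge0.
  move: (_ - _) => e e1 e2.
  rewrite -mulrA -[e]opprK 2!mulrN lerN2 ler_wpM2l// exprS invfM.
  by apply: ler_pM; rewrite ?invr_ge0 ?oppr_ge0 ?(ltW wl)// lerNl.
rewrite sumrN lerN2 -mulr_suml ler_wpM2r ?invr_ge0 ?exprn_ge0 ?(ltW w0)//.
apply: le_trans _ (sum_down_rate_le theta_gt0 lam).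
rewrite [leRHS](bigID (can_down lam))/= lerDl; apply: sumr_ge0 => i _.
exact: down_rate_ge0.
Qed.

(** Minus the loop function at the random point [x], times [x - S], is at least
    a multiple of the square of [x - S], and its mean is small by
    [mean_loop_ge]. *)
Lemma mean_square_bound (S : R) : 0 <= S -> psi S = 0 ->
  exists C : R, forall N : nat, (0 < N)%N -> theta <= s * N%:R ->
    \sum_(lam : box_partition N (Num.truncn (M * N%:R)))
       ensemble_pmf theta lam * (resolvent_sum (s * N%:R) lam - S) ^+ 2 <= C / N%:R.
Proof.
move=> S0 psiS.
pose C0 := (2 + theta) + (s + M + theta) * ((theta ^+ 2 + theta) / s ^+ 2) +
    s * (expR (theta / s) * (theta / s) ^+ 2).
exists ((theta * (M + theta) / s ^+ 3 + C0 * (s^-1 + S)) / (s * theta)) => N N0 tw.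
set K := Num.truncn _; set n := N%:R => {}.
have n0 : 0 < n by rewrite ltr0n.
have n1 : 1 <= n by rewrite ler1n.
have s0 := s_gt0; have t0 := theta_gt0; have m0 := M_gt0.
pose w := s * n; have w0 : 0 < w by rewrite mulr_gt0.
have KM : K%:R <= M * n < K%:R + 1.
  by have := @truncn_itv _ (M * n); rewrite natr1; apply; rewrite mulr_ge0 ?ltW.
have C00 : 0 <= C0.
  rewrite /C0; apply: addr_ge0.
    apply: addr_ge0; first lra.
    by apply: mulr_ge0; [lra|rewrite divr_ge0 ?sqr_ge0// addr_ge0 ?sqr_ge0// ltW].
  apply: mulr_ge0; first exact: ltW.
  by apply: mulr_ge0; [exact: expR_ge0|exact: sqr_ge0].
have p0 (lam : box_partition N K) : 0 <= ensemble_pmf theta lam.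
  by rewrite ltW// ensemble_pmf_gt0.
have p1 := ensemble_pmf_sum1 theta_gt0 N K.
have H := @mean_loop_ge w S N K w0.
move: (@ensemble_pmf R theta N K) p0 p1 H => p p0 p1 H.
pose L (lam : box_partition N K) := loop_expression theta N (ell theta lam) w (ell_max theta N K).
pose x (lam : box_partition N K) := resolvent_sum w lam.
have x0 lam : 0 <= x lam.
  by apply: sumr_ge0 => i _; rewrite invr_ge0 addr_ge0 ?ell_ge0// ltW.
have xs lam : x lam <= s^-1.
  apply: (@le_trans _ _ (\sum_(i < N) w^-1)).
    apply: ler_sum => i _; rewrite lef_pV2 ?posrE// ?ltr_wpDr// ?ell_ge0//.
    by rewrite lerDl ell_ge0.
  rewrite sumr_const card_ord -[X in X <= _]mulr_natr -/n /w le_eqVlt; apply/orP; left.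
  by apply/eqP; field; rewrite !gt_eqF.
have LE lam : `|L lam / n - psi (x lam)| <= C0 / n.
  apply: loop_expression_dist => //.
  - by move: KM => /andP[? ?]; rewrite ler_norml; apply/andP; split; lra.
  - by move=> i; exact: ell_ge0.
(* the loop function is traded for the loop expression, at a cost of C0 / n *)
have step lam : s * theta * (x lam - S) ^+ 2 <=
    - (n^-1 * (L lam * (x lam - S))) + C0 / n * (s^-1 + S).
  apply: le_trans (loop_function_coercive theta_gt0 M_gt0 s_gt0 (x0 lam) S0 psiS) _.
  have -> : - psi (x lam) * (x lam - S) = - (n^-1 * (L lam * (x lam - S))) +
      (L lam / n - psi (x lam)) * (x lam - S) by ring.
  rewrite lerD2l (le_trans (ler_norm _))// normrM ler_pM//.
  by have := x0 lam; have := xs lam; rewrite ler_norml => ? ?; apply/andP; split; lra.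
have st0 : 0 < s * theta by rewrite mulr_gt0.
rewrite -mulrA mulrCA ler_pdivlMl// mulr_sumr.
apply: (@le_trans _ _ (\sum_lam (- (n^-1 * (p lam * (L lam * (x lam - S)))) +
    p lam * (C0 / n * (s^-1 + S))))).
  apply: ler_sum => lam _; rewrite mulrCA.
  have := ler_wpM2l (p0 lam) (step lam); rewrite mulrDr => /le_trans; apply.
  by rewrite lerD2r mulrN mulrCA.
rewrite big_split/= sumrN -mulr_sumr -mulr_suml p1 mul1r [leRHS]mulrDl.
apply: lerD; last by rewrite le_eqVlt; apply/orP; left; apply/eqP; ring.
apply: (@le_trans _ _ (n^-1 * (theta * ell_max theta N K * n / w ^+ 3))).
  by rewrite -mulrN ler_pM2l ?invr_gt0// lerNl.
have topn : ell_max theta N K <= (M + theta) * n.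
  by move: KM => /andP[? ?]; rewrite /ell_max -/n mulrDl; lra.
have topE : n^-1 * (theta * ell_max theta N K * n / w ^+ 3) =
    theta / s ^+ 3 / n ^+ 3 * ell_max theta N K by rewrite /w; field; rewrite !gt_eqF.
rewrite topE; apply: (@le_trans _ _ (theta / s ^+ 3 / n ^+ 3 * ((M + theta) * n))).
  by rewrite ler_wpM2l// !divr_ge0// ?exprn_ge0// ltW.
have -> : theta / s ^+ 3 / n ^+ 3 * ((M + theta) * n) =
   theta * (M + theta) / s ^+ 3 / n * n^-1 by field; rewrite !gt_eqF.
rewrite ler_piMr ?invf_le1//.
by rewrite !divr_ge0 ?mulr_ge0 ?addr_ge0 ?exprn_ge0// ltW.
Qed.

End mean_square.

(** * The arcsine function in half-angle form *)

Section half_angle_arcsine.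
Context {R : realType}.
Implicit Types (f g : R -> R) (x t : R).

Lemma is_derive_div f g x (df dg : R) : 
  is_derive x 1 f df -> is_derive x 1 g dg -> g x != 0 ->
  is_derive x 1 (fun z => f z / g z) ((df * g x - f x * dg) / g x ^+ 2).
Proof.
move=> hf hg gx; have hgV := is_deriveV gx hg.
have := is_deriveM hf hgV; rewrite /GRing.scale/= => h.
apply: is_derive_eq h _; by field.
Qed.

(** The half-angle form of the arcsine: it agrees with it on [-1, 1] and is
    continuous on the whole line, so that it provides antiderivatives up to the
    endpoints. *)
Definition arcsin t : R := 2 * atan (t / (1 + Num.sqrt (1 - t ^+ 2))).

Let den_gt0 t : 0 < 1 + Num.sqrt (1 - t ^+ 2).
Proof. by rewrite ltr_pwDl// sqrtr_ge0. Qed.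

Lemma continuous_arcsin : continuous arcsin.
Proof.
move=> t; apply: cvgM; first exact: cvg_cst.
apply: continuous_comp; last exact: continuous_atan.
apply: cvgM; first exact: cvg_id.
apply: cvgV; first by rewrite gt_eqF.
apply: cvgD; first exact: cvg_cst.
apply: continuous_comp; last exact: sqrt_continuous.
by apply: cvgB; [exact: cvg_cst|exact: exprn_continuous].
Qed.

Lemma arcsin1 : arcsin 1 = pi / 2.
Proof. by rewrite /arcsin expr1n subrr sqrtr0 addr0 divr1 atan1; field. Qed.

Lemma arcsinN1 : arcsin (-1) = - (pi / 2).
Proof.
by rewrite /arcsin sqrrN expr1n subrr sqrtr0 addr0 divr1 atanN atan1; field.
Qed.

Lemma is_derive_arcsin t : -1 < t < 1 ->
  is_derive t 1 arcsin (Num.sqrt (1 - t ^+ 2))^-1.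
Proof.
move=> t1; have t2 : 0 < 1 - t ^+ 2 by nra.
set r : R := Num.sqrt (1 - t ^+ 2).
have r0 : 0 < r by rewrite sqrtr_gt0.
have rr : r ^+ 2 = 1 - t ^+ 2 by rewrite sqr_sqrtr// ltW.
have d1 : is_derive t 1 (fun z : R => 1 - z ^+ 2) (- (2 * t)).
  by apply: is_derive_eq; rewrite /GRing.scale/=; ring.
have d2 : is_derive t 1 (fun z : R => 1 + Num.sqrt (1 - z ^+ 2)) (- t / r).
  have h := @is_derive1_comp _ Num.sqrt (fun z : R => 1 - z ^+ 2) _ _ _
    (is_derive1_sqrt t2) d1.
  have h1 := is_deriveD (is_derive_cst (1 : R) t 1) h.
  apply: is_derive_eq h1 _; rewrite -/r; field; exact: lt0r_neq0.
have d3 := is_derive_div (is_derive_id t 1) d2 (lt0r_neq0 (den_gt0 t)).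
have d4 := @is_derive1_comp _ _ _ _ _ _ (is_derive1_atan _) d3.
have d5 := is_deriveZ (2 : R) d4.
apply: is_derive_eq d5 _; rewrite /GRing.scale/= -/r.
have h1 : 1 + r != 0 by exact: lt0r_neq0 (den_gt0 t).
have h2 : (1 + r) ^+ 2 + t ^+ 2 != 0 by rewrite gt_eqF//; nra.
have tt : t ^+ 2 = 1 - r ^+ 2 by rewrite rr; ring.
have rN := lt0r_neq0 r0.
have -> : 1 + (t / (1 + r)) ^+ 2 = 2 / (1 + r) by rewrite expr_div_n tt; field.
have -> : 1 * (1 + r) - t * (- t / r) = (1 + r) / r.
  have -> : 1 * (1 + r) - t * (- t / r) = (r * (1 + r) + t ^+ 2) / r by field.
  by rewrite tt; field.
by field; rewrite rN h1.
Qed.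

Lemma arcsinE t : -1 < t < 1 -> arcsin t = atan (t / Num.sqrt (1 - t ^+ 2)).
Proof.
move=> t1; have t2 : 0 < 1 - t ^+ 2 by nra.
set r : R := Num.sqrt (1 - t ^+ 2).
have r0 : 0 < r by rewrite sqrtr_gt0.
have rr : r ^+ 2 = 1 - t ^+ 2 by rewrite sqr_sqrtr// ltW.
have tt : t ^+ 2 = 1 - r ^+ 2 by rewrite rr; ring.
have r1 : 0 < 1 + r by rewrite addr_gt0.
rewrite /arcsin -/r; set u := t / (1 + r).
have u1 : -1 < u < 1 by rewrite /u ltr_pdivlMr// ltr_pdivrMr//; lra.
have au : - (pi / 4) < atan u < (pi / 4 : R).
  by rewrite -atan1 -atanN; apply/andP; split; apply: lt_atan; case/andP: u1.
have cu : cos (atan u) != 0.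
  by rewrite gt_eqF// cos_gt0_pihalf// atan_gtNpi2 atan_ltpi2.
rewrite -[LHS]tanK; last by rewrite in_itv/=; have := @pi_gt0 R; lra.
congr atan; rewrite mulr_natl tan_mulr2n// atanK /u.
have -> : 1 - (t / (1 + r)) ^+ 2 = 2 * r / (1 + r).
  by rewrite expr_div_n tt; field; exact: lt0r_neq0.
by rewrite -mulr_natl; field; rewrite !lt0r_neq0.
Qed.

End half_angle_arcsine.

(** * Arcsine integrals *)

Section arcsine_integrals.
Context {R : realType}.
Local Notation mu := (@lebesgue_measure R).

Let continuous_inv_sqrt (h : R -> R) (x : R) : {for x, continuous h} -> 0 < h x ->
  {for x, continuous (fun z => (Num.sqrt (h z))^-1)}.
Proof.
move=> ch hx; apply: cvgV; first by rewrite gt_eqF// sqrtr_gt0.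
by apply: continuous_comp; [exact: ch|exact: sqrt_continuous].
Qed.

Let continuous_sub_sq (k c x : R) : {for x, continuous (fun z : R => k - (z - c) ^+ 2)}.
Proof.
apply: cvgB; first exact: cvg_cst.
apply: (@cvg_comp _ _ _ (fun z : R => z - c) (fun z : R => z ^+ 2) _ (nbhs (x - c))).
  by apply: cvgB; [exact: cvg_id|exact: cvg_cst].
exact: exprn_continuous.
Qed.


Lemma integral_arcsine_tail (q b : R) : 0 < q -> - q <= b < q ->
  (\int[mu]_(t in `]b, q[) (Num.sqrt (q ^+ 2 - t ^+ 2))^-1%:E =
   (pi / 2 - arcsin (b / q))%:E)%E.
Proof.
move=> q0 /andP[qb bq].
have cF : continuous (fun t : R => arcsin (t / q)).
  move=> t; apply: (@continuous_comp _ _ _ (fun t : R => t / q) arcsin).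
    by apply: cvgM; [exact: cvg_id|exact: cvg_cst].
  exact: continuous_arcsin.
have qN := lt0r_neq0 q0.
apply: (@ge0_open_ftc _ (fun t : R => (Num.sqrt (q ^+ 2 - t ^+ 2))^-1)
  (fun t : R => arcsin (t / q))).
- exact: bq.
- by move=> t _; rewrite invr_ge0 sqrtr_ge0.
- move=> t /andP[bt tq]; apply: continuous_inv_sqrt; last by nra.
  by apply: cvgB; [exact: cvg_cst|exact: exprn_continuous].
- move=> t /andP[bt tq].
  have t1 : -1 < t / q < 1 by rewrite ltr_pdivlMr// ltr_pdivrMr//; lra.
  have d1 : is_derive t 1 (fun t : R => t / q) q^-1.
    by apply: is_derive_eq; rewrite /GRing.scale/=; ring.
  have d2 := @is_derive1_comp _ _ (fun t : R => t / q) _ _ _ (is_derive_arcsin t1) d1.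
  apply: is_derive_eq d2 _.
  rewrite -invfM; congr (_^-1).
  rewrite -[q in _ * q](ger0_norm (ltW q0)) -sqrtr_sqr -sqrtrM; last by nra.
  by congr Num.sqrt; field.
- by apply: cvg_at_right_filter; exact: cF.
- have -> : pi / 2 = arcsin (q / q) by rewrite divff// arcsin1.
  by apply: cvg_at_left_filter; exact: cF.
Qed.

(** The Stieltjes transform of the arcsine law, up to the factor [pi]. The
    antiderivative is the arcsine of the homography that maps the ends of the
    support to [-1] and [1] and has its pole at [x = c - y]. *)
Lemma integral_arcsine_stieltjes (rho y c : R) : 0 < rho < y ->
  (\int[mu]_(x in `](c - rho)%R, (c + rho)%R[)
     ((x - c + y)^-1 * (Num.sqrt (rho ^+ 2 - (x - c) ^+ 2))^-1)%:E =
   (pi / Num.sqrt (y ^+ 2 - rho ^+ 2))%:E)%E.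
Proof.
move=> /andP[r0 ry].
set D := Num.sqrt (y ^+ 2 - rho ^+ 2).
have D2 : 0 < y ^+ 2 - rho ^+ 2 by nra.
have D0 : 0 < D by rewrite sqrtr_gt0.
pose h (x : R) : R := (y * (x - c) + rho ^+ 2) / (rho * (x - c + y)).
have rN := lt0r_neq0 r0.
have hden (x : R) : c - rho <= x -> 0 < x - c + y by move=> ?; lra.
have ch (x : R) : c - rho <= x -> {for x, continuous h}.
  move=> /hden x0; apply: cvgM.
    apply: cvgD; last exact: cvg_cst.
    by apply: cvgM; [exact: cvg_cst|apply: cvgB; [exact: cvg_id|exact: cvg_cst]].
  apply: cvgV; first by rewrite lt0r_neq0// mulr_gt0.
  apply: cvgM; first exact: cvg_cst.
  by apply: cvgD; [apply: cvgB; [exact: cvg_id|exact: cvg_cst]|exact: cvg_cst].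
have cF (x : R) : c - rho <= x -> {for x, continuous (fun x : R => arcsin (h x) / D)}.
  move=> /ch hx; apply: cvgM; last exact: cvg_cst.
  by apply: (@continuous_comp _ _ _ h arcsin); [exact: hx|exact: continuous_arcsin].
have -> : pi / D = arcsin (h (c + rho)) / D - arcsin (h (c - rho)) / D.
  have -> : h (c + rho) = 1.
    by rewrite /h; field; rewrite rN gt_eqF//; lra.
  have -> : h (c - rho) = -1.
    by rewrite /h; field; rewrite rN gt_eqF//; lra.
  by rewrite arcsin1 arcsinN1; field; exact: lt0r_neq0.
apply: (@ge0_open_ftc _
  (fun x : R => (x - c + y)^-1 * (Num.sqrt (rho ^+ 2 - (x - c) ^+ 2))^-1)
  (fun x : R => arcsin (h x) / D)).
- by lra.
- move=> x /andP[rx xr]; have := hden x (ltW rx) => x0.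
  by rewrite /= mulr_ge0 ?invr_ge0 ?sqrtr_ge0// ltW.
- move=> x /andP[rx xr]; have x0 := hden x (ltW rx).
  apply: cvgM.
    apply: cvgV; first exact: lt0r_neq0.
    by apply: cvgD; [apply: cvgB; [exact: cvg_id|exact: cvg_cst]|exact: cvg_cst].
  apply: (@continuous_inv_sqrt (fun x : R => rho ^+ 2 - (x - c) ^+ 2)).
    exact: continuous_sub_sq.
  by nra.
- move=> x /andP[rx xr]; have x0 := hden x (ltW rx); have xN := lt0r_neq0 x0.
  have z2 : 0 < rho ^+ 2 - (x - c) ^+ 2 by nra.
  set z := x - c in x0 xN z2 *.
  have sqE : 1 - h x ^+ 2 =
      (rho ^+ 2 - z ^+ 2) * (y ^+ 2 - rho ^+ 2) / (rho * (z + y)) ^+ 2.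
    by rewrite /h -/z; field; rewrite rN xN.
  have p0 : 0 < rho * (z + y) by rewrite mulr_gt0.
  have h2 : 0 < 1 - h x ^+ 2 by rewrite sqE divr_gt0 ?exprn_gt0// mulr_gt0.
  have h1 : -1 < h x < 1 by nra.
  have dn : is_derive x 1 (fun x : R => y * (x - c) + rho ^+ 2) y.
    by apply: is_derive_eq; rewrite /GRing.scale/=; ring.
  have dd : is_derive x 1 (fun x : R => rho * (x - c + y)) rho.
    by apply: is_derive_eq; rewrite /GRing.scale/=; ring.
  have dh := is_derive_div dn dd (lt0r_neq0 p0).
  have dA := @is_derive1_comp _ _ h _ _ _ (is_derive_arcsin h1) dh.
  have dF := is_deriveZ (D^-1) dA.
  rewrite (_ : (fun x : R => arcsin (h x) / D) = D^-1 *: (arcsin \o h)); last first.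
    by apply/funext => u; rewrite mulrC.
  apply: is_derive_eq dF _; rewrite /GRing.scale/= -/z.
  have -> : Num.sqrt (1 - h x ^+ 2) =
      Num.sqrt (rho ^+ 2 - z ^+ 2) * D / (rho * (z + y)).
    rewrite sqE sqrtrM; last by rewrite mulr_ge0 ?ltW.
    rewrite sqrtrV ?sqr_ge0// sqrtr_sqr (ger0_norm (ltW p0)) sqrtrM ?ltW//.
  have DD : D ^+ 2 = y ^+ 2 - rho ^+ 2 by rewrite sqr_sqrtr// ltW.
  have s0 : 0 < Num.sqrt (rho ^+ 2 - z ^+ 2) by rewrite sqrtr_gt0.
  move: (Num.sqrt _) s0 => s s0.
  have -> : y * (rho * (z + y)) - (y * z + rho ^+ 2) * rho = rho * D ^+ 2.
    by rewrite DD; ring.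
  by field; rewrite rN xN !lt0r_neq0.
- by apply: cvg_at_right_filter; apply: cF; lra.
- by apply: cvg_at_left_filter; apply: cF; lra.
Qed.

Lemma integral_inv_sqrt_add (k a c : R) : 0 < k -> a < c ->
  (\int[mu]_(t in `]a, c[) (Num.sqrt (k + t ^+ 2))^-1%:E =
   (ln ((c + Num.sqrt (k + c ^+ 2)) / (a + Num.sqrt (k + a ^+ 2))))%:E)%E.
Proof.
move=> k0 ac.
have k2 (t : R) : 0 < k + t ^+ 2 by rewrite ltr_pwDl// sqr_ge0.
have pos (t : R) : 0 < t + Num.sqrt (k + t ^+ 2).
  rewrite -ltrBlDl sub0r (le_lt_trans (ler_norm _))// normrN -sqrtr_sqr.
  by rewrite ltr_sqrt// ltrDr.
pose F t := ln (t + Num.sqrt (k + t ^+ 2)).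
have dF (t : R) : is_derive t 1 F (Num.sqrt (k + t ^+ 2))^-1.
  have d1 : is_derive t 1 (fun z : R => k + z ^+ 2) (2 * t).
    by apply: is_derive_eq; rewrite /GRing.scale/=; ring.
  have d2 := @is_derive1_comp _ Num.sqrt (fun z : R => k + z ^+ 2) _ _ _
    (is_derive1_sqrt (k2 t)) d1.
  have d3 := is_deriveD (is_derive_id t (1 : R)) d2.
  have d4 := @is_derive1_comp _ _ (fun t : R => t + Num.sqrt (k + t ^+ 2)) _ _ _
    (is_derive1_ln (pos t)) d3.
  apply: is_derive_eq d4 _; rewrite /=.
  have s0 : 0 < Num.sqrt (k + t ^+ 2) by rewrite sqrtr_gt0.
  by have := pos t; move: (Num.sqrt _) s0 => s s0 ts; field; rewrite !lt0r_neq0.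
have cF (t : R) : {for t, continuous F}.
  by apply: differentiable_continuous; apply/derivable1_diffP; have [] := dF t.
rewrite ln_div ?posrE// -/(F c) -/(F a).
apply: (@ge0_open_ftc _ (fun t : R => (Num.sqrt (k + t ^+ 2))^-1) F).
- exact: ac.
- by move=> t _; rewrite invr_ge0 sqrtr_ge0.
- move=> t _; apply: continuous_inv_sqrt => //.
  by apply: cvgD; [exact: cvg_cst|exact: exprn_continuous].
- by apply: cvg_at_right_filter; exact: cF.
- by apply: cvg_at_left_filter; exact: cF.
Qed.

End arcsine_integrals.

(** * The limit density as a mixture of arcsine laws *)

Section measurability_and_support.
Context {R : realType}.
Local Notation mu := (@lebesgue_measure R).

Lemma measurable_invr : measurable_fun setT (fun x : R => x^-1).
Proof.
rewrite (_ : (fun x : R => x^-1) = (fun x => x * (x ^+ 2) `^ (-1))); last first.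
  apply/funext => x; rewrite powR_inv1 ?sqr_ge0//.
  by have [->|x0] := eqVneq x 0; [rewrite invr0 mul0r|field].
apply: measurable_funM; first exact: measurable_id.
apply: (@measurableT_comp _ _ _ _ _ _ (fun t : R => t `^ (-1)) _ (fun x : R => x ^+ 2)).
  exact: measurable_powR.
exact: measurable_funX.
Qed.

Lemma measurable_sqrt : measurable_fun setT (@Num.sqrt R).
Proof. by apply: continuous_measurable_fun; exact: sqrt_continuous. Qed.

Lemma integral_supported (A B : set R) (f : R -> \bar R) : A `<=` B ->
  (forall x, B x -> ~ A x -> f x = 0%E) ->
  (\int[mu]_(x in B) f x = \int[mu]_(x in A) f x)%E.
Proof.
move=> AB f0; rewrite integral_mkcond [RHS]integral_mkcond.
apply: eq_integral => x _; rewrite /patch.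
case: ifPn => [|Bx]; case: ifPn => //.
- by rewrite !notin_setE inE => Ax Bx; rewrite f0.
- by move: Bx; rewrite notin_setE inE => Bx /AB.
Qed.

End measurability_and_support.

Section arcsine_mixture.
Context {R : realType}.
Local Notation mu := (@lebesgue_measure R).

Let ler_sq (u v : R) : - v <= u <= v -> u ^+ 2 <= v ^+ 2.
Proof. by move=> /andP[? ?]; nra. Qed.

Let ltr_sq (u v : R) : - v < u < v -> u ^+ 2 < v ^+ 2.
Proof. by move=> /andP[? ?]; nra. Qed.

Variables theta M : R.
Hypotheses (theta_gt0 : 0 < theta) (M_gt0 : 0 < M).

Local Notation B := (M + theta).
Local Notation a := ((M - theta) / 2).
Local Notation c := ((M + theta) / 2).
Local Notation phi := (limit_density theta M).

(** Square roots of negative numbers and the inverse of [0] are [0], so that the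
    kernel vanishes off the support without an indicator function. *)
Let kernel (x t : R) : R := (Num.sqrt (x * (B - x) - t ^+ 2))^-1.

Let kernel_ge0 x t : 0 <= kernel x t.
Proof. by rewrite invr_ge0 sqrtr_ge0. Qed.

Let kernel0 x t : x * (B - x) <= t ^+ 2 -> kernel x t = 0.
Proof. by move=> h; rewrite /kernel ler0_sqrtr ?invr0// subr_le0. Qed.

(** The density is a mixture of arcsine densities centred at [c], of squared
    radii [c ^+ 2 - t ^+ 2]. A point [x] is in the support of the member [t]
    when [`|t| < q], where [q ^+ 2 = x * (B - x)]; the three regimes of the
    density correspond to an interval of parameters, starting at [a], that
    misses, cuts or contains the interval from [- q] to [q]. *)
Lemma limit_density_arcsine_mixture x : 0 < x < B ->
  (\int[mu]_(t in `]a, c[) (kernel x t)%:E = (theta * pi * phi x)%:E)%E.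
Proof.
move=> /andP[x0 xB]; have t0 := theta_gt0; have m0 := M_gt0.
have pi0 := @pi_gt0 R.
pose q := Num.sqrt (x * (B - x)).
have Q0 : 0 < x * (B - x) by rewrite mulr_gt0// subr_gt0.
have q0 : 0 < q by rewrite sqrtr_gt0.
have q2 : q ^+ 2 = x * (B - x) by rewrite sqr_sqrtr// ltW.
have qc : q <= c.
  rewrite -(@ler_pXn2r _ 2%N) ?nnegrE ?(ltW q0)// ?q2; last by lra.
  rewrite -subr_ge0 (_ : _ - _ = (x - c) ^+ 2) ?sqr_ge0//; by field.
have kE t : kernel x t = (Num.sqrt (q ^+ 2 - t ^+ 2))^-1 by rewrite /kernel q2.
set y := x - c.
have y2 : y ^+ 2 = c ^+ 2 - q ^+ 2 by rewrite q2 /y; field.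
have ac2 : c ^+ 2 - a ^+ 2 = M * theta by field.
have Mt0 : 0 < M * theta by rewrite mulr_gt0.
have bulk_iff : (`|y| < Num.sqrt (M * theta)) = (a ^+ 2 < q ^+ 2).
  by rewrite -sqrtr_sqr ltr_sqrt// y2 -ac2; apply/idP/idP; lra.
have [qa|aq] := leP q a.
  have -> : phi x = 0.
    rewrite /limit_density -/y bulk_iff.
    have -> : theta <= M by lra.
    by rewrite ltNge (ler_sq (u := q))//; apply/andP; split; lra.
  rewrite mulr0 integral0_eq// => t /=; rewrite in_itv/= => /andP[at_ _].
  by rewrite kernel0// -q2 ler_sq//; apply/andP; split; lra.
have [aNq|qNa] := leP a (- q).
  have -> : phi x = theta^-1.
    rewrite /limit_density -/y bulk_iff.
    have -> : theta <= M = false by apply/negbTE; rewrite -ltNge; lra.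
    rewrite ltNge -(sqrrN a) (ler_sq (u := q))/=; last by apply/andP; split; lra.
    by rewrite (_ : `|y| <= c)// /y ler_norml; apply/andP; split; lra.
  rewrite (@integral_supported _ `]- q, q[).
  - under eq_integral do rewrite kE.
    rewrite (integral_arcsine_tail q0); last by rewrite lexx/=; lra.
    by rewrite mulNr divff ?lt0r_neq0// arcsinN1; congr _%:E; field; exact: lt0r_neq0.
  - by move=> t /=; rewrite !in_itv/= => /andP[h1 h2]; apply/andP; split; lra.
  - move=> t _ /=; rewrite in_itv/= => /negP; rewrite negb_and -!leNgt => h.
    rewrite kernel0// -q2; case/orP: h => h; first rewrite -(sqrrN t);
      by apply: ler_sq; apply/andP; split; lra.
have aq2 : a ^+ 2 < q ^+ 2 by rewrite ltr_sq// qNa aq.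
have -> : phi x = (theta * pi)^-1 * arccot (a / Num.sqrt (q ^+ 2 - a ^+ 2)).
  rewrite /limit_density -/y bulk_iff aq2.
  have -> : M * theta - y ^+ 2 = q ^+ 2 - a ^+ 2 by rewrite y2 -ac2; ring.
  have -> : (M - theta) / (2 * Num.sqrt (q ^+ 2 - a ^+ 2)) =
      a / Num.sqrt (q ^+ 2 - a ^+ 2) by rewrite invfM mulrA.
  by case: ifP.
rewrite (@integral_supported _ `]a, q[).
- under eq_integral do rewrite kE.
  rewrite (integral_arcsine_tail q0) ?(ltW qNa)//.
  rewrite mulrA divff ?mulf_neq0 ?lt0r_neq0// mul1r /arccot.
  have a1 : -1 < a / q < 1 by rewrite ltr_pdivlMr// ltr_pdivrMr//; lra.
  rewrite (arcsinE a1); congr (_ - atan _)%:E.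
  have -> : 1 - (a / q) ^+ 2 = (q ^+ 2 - a ^+ 2) / q ^+ 2 by field; exact: lt0r_neq0.
  rewrite sqrtrM; last by rewrite subr_ge0 ltW.
  rewrite sqrtrV ?sqr_ge0// sqrtr_sqr (ger0_norm (ltW q0)).
  have : 0 < Num.sqrt (q ^+ 2 - a ^+ 2) by rewrite sqrtr_gt0 subr_gt0.
  by move: (Num.sqrt _) => s s0; field; rewrite !lt0r_neq0.
- by move=> t /=; rewrite !in_itv/= => /andP[-> h2]/=; lra.
- move=> t /=; rewrite !in_itv/= => /andP[-> _]/=/negP; rewrite -leNgt => h.
  by rewrite kernel0// -q2 ler_sq//; apply/andP; split; lra.
Qed.

Variable s : R.
Hypothesis s_gt0 : 0 < s.

Local Notation y := (s + c).

Let kernel_out x t : ~ 0 < x < B -> kernel x t = 0.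
Proof.
move=> /negP; rewrite negb_and -!leNgt => h; apply: kernel0.
have t0 := theta_gt0; have m0 := M_gt0.
apply: le_trans (sqr_ge0 t); case/orP: h => h.
  by rewrite mulr_le0_ge0// subr_ge0; lra.
by rewrite mulr_ge0_le0 ?subr_le0//; lra.
Qed.

Let I : set R := `]a, c[%classic.

Let f (z : R * R) : \bar R := ((z.1 + s)^-1 * kernel z.1 z.2 * \1_I z.2)%:E.

Let f_ge0 z : (0 <= f z)%E.
Proof.
rewrite lee_fin; have [/andP[x0 _]|xB] := boolP (0 < z.1 < B); last first.
  by rewrite kernel_out ?mulr0 ?mul0r//; exact/negP.
by rewrite !mulr_ge0// invr_ge0 addr_ge0 ?ltW.
Qed.

Let measurable_f : measurable_fun setT f.
Proof.
apply/measurable_EFinP; apply: measurable_funM; last first.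
  apply: (@measurableT_comp _ _ _ _ _ _ (\1_I : R -> R) _ snd) => //.
  by apply: measurable_indic; exact: measurable_itv.
apply: measurable_funM.
  apply: (@measurableT_comp _ _ _ _ _ _ (fun x : R => x^-1) _ (fun z : R * R => z.1 + s)).
    exact: measurable_invr.
  by apply: measurable_funD.
apply: (@measurableT_comp _ _ _ _ _ _ (fun x : R => x^-1) _
  (fun z : R * R => Num.sqrt (z.1 * (B - z.1) - z.2 ^+ 2))).
  exact: measurable_invr.
apply: (@measurableT_comp _ _ _ _ _ _ (@Num.sqrt R)); first exact: measurable_sqrt.
apply: measurable_funB.
  by apply: measurable_funM => //; apply: measurable_funB.
exact: measurable_funX.
Qed.

Let integral_t x :
  (\int[mu]_t f (x, t) = \int[mu]_(t in I) ((x + s)^-1 * kernel x t)%:E)%E.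
Proof.
rewrite [RHS]integral_mkcond; apply: eq_integral => t _.
rewrite /patch /f /= indicE; case: ifP => tI; rewrite ?mulr1 ?mulr0//.
Qed.

Let integral_x : (\int[mu]_x \int[mu]_t f (x, t) =
  \int[mu]_(x in `]0%R, B[) ((x + s)^-1 * (theta * pi * phi x))%:E)%E.
Proof.
rewrite [RHS]integral_mkcond; apply: eq_integral => x _.
rewrite integral_t /patch /=; case: ifPn => [|]; last first.
  rewrite notin_setE/= in_itv/= => xB.
  by rewrite integral0_eq// => t _; rewrite kernel_out ?mulr0.
rewrite inE/= in_itv/= => x0B; have /andP[x0 xB] := x0B.
under eq_integral do rewrite EFinM.
rewrite ge0_integralZl//.
- rewrite [X in (_ * X)%E](limit_density_arcsine_mixture x0B).
  by rewrite -EFinM.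
- exact: measurable_itv.
- apply/measurable_EFinP; apply: measurable_funTS.
  apply: (@measurableT_comp _ _ _ _ _ _ (fun x : R => x^-1)).
    exact: measurable_invr.
  apply: (@measurableT_comp _ _ _ _ _ _ (@Num.sqrt R)); first exact: measurable_sqrt.
  by apply: measurable_funB => //; exact: measurable_funX.
- by move=> t _; rewrite lee_fin.
- by rewrite lee_fin invr_ge0 addr_ge0// ltW.
Qed.

Let integral_xt t : I t -> (\int[mu]_x f (x, t) =
  (pi / Num.sqrt (y ^+ 2 - c ^+ 2 + t ^+ 2))%:E)%E.
Proof.
rewrite /I/= in_itv/= => tI; have /andP[at_ tc] := tI.
have t0 := theta_gt0; have m0 := M_gt0; have s0 := s_gt0.
pose rho := Num.sqrt (c ^+ 2 - t ^+ 2).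
have c2 : 0 < c ^+ 2 - t ^+ 2.
  rewrite (_ : _ - _ = (c - t) * (c + t)); last by ring.
  by apply: mulr_gt0; lra.
have r0 : 0 < rho by rewrite sqrtr_gt0.
have r2 : rho ^+ 2 = c ^+ 2 - t ^+ 2 by rewrite sqr_sqrtr// ltW.
have rc : rho <= c.
  rewrite -(@ler_pXn2r _ 2%N) ?nnegrE ?(ltW r0)// ?r2; last by lra.
  by rewrite lerBlDr lerDl sqr_ge0.
have quadE x : x * (B - x) - t ^+ 2 = rho ^+ 2 - (x - c) ^+ 2 by rewrite r2; field.
rewrite (@integral_supported _ `](c - rho)%R, (c + rho)%R[%classic) //; last first.
  move=> x _ /=; rewrite in_itv/= => /negP; rewrite negb_and -!leNgt => h.
  rewrite /f /= kernel0 ?mulr0 ?mul0r// -subr_le0 quadE.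
  rewrite (_ : _ - _ = (rho - (x - c)) * (rho + (x - c))); last by ring.
  case/orP: h => h; first by rewrite mulr_ge0_le0//; lra.
  by rewrite mulr_le0_ge0//; lra.
have ry : 0 < rho < y by apply/andP; split; lra.
rewrite (_ : y ^+ 2 - c ^+ 2 + t ^+ 2 = y ^+ 2 - rho ^+ 2); last by rewrite r2; ring.
rewrite -(integral_arcsine_stieltjes c ry); apply: eq_integral => x _.
rewrite /f /= indicE mem_set/= ?mulr1; last by rewrite /I/= in_itv.
by rewrite /kernel quadE; congr (_^-1 * _)%:E; ring.
Qed.

(** Exchange the mixture and the transform: each arcsine law has an algebraic
    transform, and integrating these over the parameter gives a logarithm. *)
Lemma limit_density_stieltjes :
  (\int[mu]_(x in `]0%R, B[) ((x + s)^-1 * (theta * pi * phi x))%:E =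
   (pi * ln ((c + y) / (a + Num.sqrt (y ^+ 2 - c ^+ 2 + a ^+ 2))))%:E)%E.
Proof.
have t0 := theta_gt0; have m0 := M_gt0; have s0 := s_gt0.
have pi0 := @pi_gt0 R.
rewrite -integral_x (@fubini_tonelli _ _ _ _ R mu mu f measurable_f f_ge0).
have k0 : 0 < y ^+ 2 - c ^+ 2.
  rewrite (_ : _ - _ = s * (s + 2 * c)); last by ring.
  by apply: mulr_gt0; lra.
have cy : Num.sqrt (y ^+ 2 - c ^+ 2 + c ^+ 2) = y.
  by rewrite subrK sqrtr_sqr ger0_norm//; lra.
have ac : a < c by lra.
rewrite (@integral_supported _ I setT)//; last first.
  move=> t _ It; rewrite integral0_eq// => x _.
  by rewrite /f /= indicE memNset// mulr0.
transitivity (\int[mu]_(t in I) (pi * (Num.sqrt (y ^+ 2 - c ^+ 2 + t ^+ 2))^-1)%:E)%E.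
  by apply: eq_integral => t; rewrite inE => /integral_xt.
under eq_integral do rewrite EFinM.
rewrite ge0_integralZl//.
- by rewrite (integral_inv_sqrt_add k0 ac) cy.
- exact: measurable_itv.
- apply/measurable_EFinP; apply: measurable_funTS.
  apply: (@measurableT_comp _ _ _ _ _ _ (fun x : R => x^-1)).
    exact: measurable_invr.
  apply: (@measurableT_comp _ _ _ _ _ _ (@Num.sqrt R)); first exact: measurable_sqrt.
  by apply: measurable_funD => //; exact: measurable_funX.
- by rewrite lee_fin ltW.
Qed.

End arcsine_mixture.

(** * The limit measure *)

Section limit_measure.
Context {R : realType}.
Local Notation mu := (@lebesgue_measure R).
Variables theta M : R.
Hypotheses (theta_gt0 : 0 < theta) (M_gt0 : 0 < M).

Local Notation B := (M + theta).
Local Notation phi := (limit_density theta M).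

Lemma limit_density_bounds x : 0 <= phi x <= theta^-1.
Proof.
have t0 := theta_gt0; have pi0 := @pi_gt0 R.
have bulk (z : R) : 0 <= (theta * pi)^-1 * arccot z <= theta^-1.
  have tp : 0 < (theta * pi)^-1 by rewrite invr_gt0 mulr_gt0.
  rewrite (mulr_ge0 (ltW tp) (ltW (arccot_gt0 z)))/=.
  have -> : theta^-1 = (theta * pi)^-1 * pi by rewrite invfM mulfVK ?lt0r_neq0.
  by rewrite (ler_pM2l tp) ltW// arccot_ltpi.
have ti : 0 <= theta^-1 by rewrite invr_ge0 ltW.
by rewrite /limit_density; do ![case: ifP => _//]; rewrite ?lexx ?ti.
Qed.

Lemma limit_density_out x : ~ 0 <= x <= B -> phi x = 0.
Proof.
move=> xB; have t0 := theta_gt0; have m0 := M_gt0.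
have y1 : (M + theta) / 2 < `|x - (M + theta) / 2|.
  move/negP: xB; rewrite negb_and -!ltNge => /orP[] h; rewrite ltr_normr; apply/orP.
    by right; lra.
  by left; lra.
have y2 : Num.sqrt (M * theta) <= `|x - (M + theta) / 2|.
  apply: le_trans (ltW y1).
  rewrite -[leRHS]ger0_norm; last by lra.
  rewrite -sqrtr_sqr ler_wsqrtr// -subr_ge0.
  rewrite (_ : _ - _ = ((M - theta) / 2) ^+ 2) ?sqr_ge0//; by field.
by rewrite /limit_density; case: ifP => _; rewrite ltNge y2//= leNgt y1.
Qed.

Lemma measurable_limit_density : measurable_fun setT phi.
Proof.
have my : measurable_fun setT (fun x : R => x - (M + theta) / 2).
  by apply: measurable_funB.
have mn : measurable_fun setT (fun x : R => `|x - (M + theta) / 2|).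
  by apply: measurableT_comp.
have mbulk : measurable_fun setT (fun x : R => (theta * pi)^-1 *
    arccot ((M - theta) / (2 * Num.sqrt (M * theta - (x - (M + theta) / 2) ^+ 2)))).
  apply: measurable_funM => //; apply: measurable_funB => //.
  apply: (@measurableT_comp _ _ _ _ _ _ (@atan R)).
    by apply: continuous_measurable_fun => x; exact: continuous_atan.
  apply: measurable_funM => //.
  apply: (@measurableT_comp _ _ _ _ _ _ (fun x : R => x^-1)).
    exact: measurable_invr.
  apply: measurable_funM => //.
  apply: (@measurableT_comp _ _ _ _ _ _ (@Num.sqrt R)); first exact: measurable_sqrt.
  by apply: measurable_funB => //; exact: measurable_funX.
have mcond : measurable_fun setT
    (fun x : R => `|x - (M + theta) / 2| < Num.sqrt (M * theta)).
  exact: measurable_fun_ltr.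
rewrite /limit_density; case: (theta <= M).
  exact: measurable_fun_ifT.
apply: measurable_fun_ifT => //; apply: measurable_fun_ifT => //.
exact: measurable_fun_ler.
Qed.

Let D : set R := `[0, +oo[%classic.

Let supp (g : R -> \bar R) : (forall x, phi x = 0 -> g x = 0%E) ->
  (\int[mu]_(x in D) g x = \int[mu]_(x in `[0%R, B]) g x)%E.
Proof.
move=> g0; apply: integral_supported => [x|x _]; rewrite /D/= !in_itv/=.
  by move=> /andP[-> _].
by move=> /limit_density_out/g0.
Qed.

Lemma integrable_limit_density (f : R -> R) (K : R) :
  measurable_fun D f -> (forall x, 0 <= x <= B -> `|f x| <= K) ->
  mu.-integrable D (fun x => (f x * phi x)%:E).
Proof.
move=> mf fK; have mD : measurable D by exact: measurable_itv.
have mfp : measurable_fun D (fun x => (f x * phi x)%:E).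
  apply/measurable_EFinP; apply: measurable_funM => //.
  by apply: measurable_funTS; exact: measurable_limit_density.
apply/integrableP; split=> //.
rewrite supp//; last by move=> x ->; rewrite mulr0 abse0.
apply: (@le_lt_trans _ _ (\int[mu]_(x in `[0%R, B]) (K * theta^-1)%:E)%E).
  apply: ge0_le_integral => //.
  - apply: measurableT_comp => //; apply: measurable_funS mfp => //.
    by move=> x; rewrite /D/= !in_itv/= => /andP[-> _].
  - move=> x /=; rewrite in_itv/= => xB; rewrite lee_fin.
    have /andP[p0 p1] := limit_density_bounds x.
    by rewrite normrM (ger0_norm p0) ler_pM// fK.
rewrite integral_cst//= lebesgue_measure_itv/= lte_fin addr_gt0//=.
by rewrite -EFinB -EFinM ltry.
Qed.

(** The exponential of [theta * S] is the algebraic number found in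
    [limit_density_stieltjes], and the equation reduces to
    [d ^+ 2 - a ^+ 2 = y ^+ 2 - c ^+ 2]. *)
Lemma loop_function_limit (s : R) : 0 < s ->
  let S := \int[mu]_(x in D) ((x + s)^-1 * phi x) in
  0 <= S /\ loop_function theta M s S = 0.
Proof.
move=> s0 S; have t0 := theta_gt0; have m0 := M_gt0; have pi0 := @pi_gt0 R.
have S0 : 0 <= S.
  apply: Rintegral_ge0 => x; rewrite /D/= in_itv/= andbT => x0.
  by have /andP[p0 _] := limit_density_bounds x; rewrite mulr_ge0// invr_ge0; lra.
split=> //.
pose y := s + (M + theta) / 2; pose c := (M + theta) / 2; pose a := (M - theta) / 2.
pose d := Num.sqrt (y ^+ 2 - c ^+ 2 + a ^+ 2).
have k0 : 0 < y ^+ 2 - c ^+ 2.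
  by rewrite (_ : _ - _ = s * (s + 2 * c)); [apply: mulr_gt0; rewrite /c; lra|rewrite /y /c; ring].
have d2 : d ^+ 2 = y ^+ 2 - c ^+ 2 + a ^+ 2.
  by rewrite sqr_sqrtr// addr_ge0 ?sqr_ge0// ltW.
have ad : 0 < a + d.
  rewrite -ltrBlDl sub0r (le_lt_trans (ler_norm _))// normrN -sqrtr_sqr.
  by rewrite ltr_sqrt ?ltrDr// ltr_pwDl// sqr_ge0.
have SE : S = theta^-1 * ln ((c + y) / (a + d)).
  rewrite /S /Rintegral supp; last by move=> x ->; rewrite mulr0.
  have mg : measurable_fun setT (fun x : R => (x + s)^-1 * phi x).
    apply: measurable_funM; last exact: measurable_limit_density.
    apply: (@measurableT_comp _ _ _ _ _ _ (fun x : R => x^-1)).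
      exact: measurable_invr.
    exact: measurable_funD.
  rewrite integral_itv_bndoo; last first.
    by apply/measurable_EFinP; exact: measurable_funTS mg.
  have tp : theta * pi != 0 by rewrite mulf_neq0 ?lt0r_neq0.
  have -> : (\int[mu]_(x in `]0%R, B[) ((x + s)^-1 * phi x)%:E =
      \int[mu]_(x in `]0%R, B[) ((theta * pi)^-1%:E *
        ((x + s)^-1 * (theta * pi * phi x))%:E))%E.
    by apply: eq_integral => x _; rewrite -EFinM; congr _%:E; rewrite mulrCA mulKf.
  rewrite ge0_integralZl//.
  - rewrite (limit_density_stieltjes t0 m0 s0) -EFinM -/c -/a -/y -/d.
    by rewrite [LHS]/= invfM -mulrA (mulKf (lt0r_neq0 pi0)).
  - apply/measurable_EFinP; apply: measurable_funTS.
    rewrite (_ : (fun x => _) = (fun x => theta * pi * ((x + s)^-1 * phi x))).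
      exact: measurable_funM.
    by apply/funext => x; rewrite mulrCA.
  - move=> x; rewrite /= in_itv/= => /andP[x0 _]; rewrite lee_fin.
    have /andP[p0 _] := limit_density_bounds x.
    by rewrite mulr_ge0 ?invr_ge0 ?addr_ge0 ?(ltW x0) ?(ltW s0)// !mulr_ge0// ltW.
  - by rewrite lee_fin invr_ge0 mulr_ge0 ?ltW.
have cy : 0 < c + y by rewrite /c /y; lra.
rewrite /loop_function SE mulNr !mulVKf ?lt0r_neq0// expRN lnK; last first.
  by rewrite posrE divr_gt0.
have -> : s + M + theta = c + y by rewrite /c /y; field.
have -> : M - theta = 2 * a by rewrite /a; field.
have -> : (c + y) * ((c + y) / (a + d))^-1 = a + d by field; rewrite !lt0r_neq0.
have -> : s * ((c + y) / (a + d)) = d - a.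
  have -> : s * ((c + y) / (a + d)) = (d ^+ 2 - a ^+ 2) / (a + d).
    by rewrite d2 /y /c; field; exact: lt0r_neq0.
  by field; exact: lt0r_neq0.
by ring.
Qed.

End limit_measure.

(** * Polynomial approximation *)

Section bernstein.

(** The Bernstein operator in recursive form: the mean of [g] after [n] steps of
    a walk that moves up with probability [t]. *)
Fixpoint bernstein (A : comPzRingType) (n : nat) (t : A) (g : nat -> A) : A :=
  if n is m.+1 then t * bernstein m t (g \o S) + (1 - t) * bernstein m t g
  else g 0%N.

Lemma bernstein_cst (A : comPzRingType) n (t b : A) : bernstein n t (fun=> b) = b.
Proof. by elim: n => //= n IH; rewrite IH; ring. Qed.

Lemma bernsteinD (A : comPzRingType) n (t : A) (g h : nat -> A) :
  bernstein n t (fun k => g k + h k) = bernstein n t g + bernstein n t h.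
Proof.
elim: n g h => //= n IH g h; rewrite IH (IH (g \o S) (h \o S)); ring.
Qed.

Lemma bernsteinZ (A : comPzRingType) n (t a : A) (g : nat -> A) :
  bernstein n t (fun k => a * g k) = a * bernstein n t g.
Proof.
elim: n g => //= n IH g; rewrite IH (IH (g \o S)); ring.
Qed.

(** For [b = n%:R * t] this is the variance of the walk. *)
Lemma bernstein_sq (A : comPzRingType) n (t b : A) :
  bernstein n t (fun k => (k%:R - b) ^+ 2) =
  n%:R * t * (1 - t) + (n%:R * t - b) ^+ 2.
Proof.
elim: n b => [|n IH] b /=; first by ring.
have -> : (fun k => (k%:R - b) ^+ 2) \o S = (fun k => (k%:R - (b - 1)) ^+ 2).
  by apply/funext => k /=; rewrite -natr1; ring.
by rewrite !IH -natr1; ring.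
Qed.

Lemma ler_bernstein (R : realType) n (t : R) (g h : nat -> R) : 0 <= t <= 1 ->
  (forall k, (k <= n)%N -> g k <= h k) -> bernstein n t g <= bernstein n t h.
Proof.
move=> /andP[t0 t1]; elim: n g h => [|n IH] g h gh /=; first exact: gh.
apply: lerD; rewrite ler_wpM2l ?subr_ge0//; apply: IH => k kn; apply: gh => //.
exact: leqW.
Qed.

Lemma bernstein_horner (R : realType) n (p : {poly R}) (x : R) (g : nat -> R) :
  (bernstein n p (fun k => (g k)%:P)).[x] = bernstein n p.[x] g.
Proof.
elim: n g => [|n IH] g /=; first by rewrite hornerC.
rewrite hornerD !hornerM hornerD hornerN hornerC IH.
by rewrite IH.
Qed.

End bernstein.

Section weierstrass.
Context {R : realType}.

Lemma segment_unif_continuous (f : R -> R) (a b e : R) :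
  {within `[a, b], continuous f} -> 0 < e ->
  exists2 d : R, 0 < d & forall x y, a <= x <= b -> a <= y <= b ->
    `|x - y| < d -> `|f x - f y| < e.
Proof.
move=> cf e0; pose K : set R := `[a, b]%classic.
have cK : compact K by exact: segment_compact.
have ncK : near_covering K by exact/compact_near_coveringP.
pose P (d x : R) := K x -> forall y, K y -> `|x - y| < d -> `|f x - f y| < e.
have h : \forall d \near 0^'+, K `<=` P d.
  apply: ncK => x Kx; move/subspace_continuousP : cf => /(_ x Kx).
  have e20 : 0 < e / 2 by rewrite divr_gt0.
  move=> /cvgrPdist_lt/(_ _ e20)[d /= d0 hd].
  exists (ball x (d / 2), [set r | r < d / 2]).
    split => /=; first by apply: nbhsx_ballx; rewrite divr_gt0.
    by apply: nbhs_right_lt; rewrite divr_gt0.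
  move=> [z r] /= [xz rd] Kz y Ky zy.
  have {}xz : `|x - z| < d / 2 by [].
  have fz : `|f x - f z| < e / 2 by apply: hd => //=; rewrite (lt_trans xz)//; lra.
  have fy : `|f x - f y| < e / 2.
    apply: hd => //=; rewrite -(subrK z x) -addrA (le_lt_trans (ler_normD _ _))//; lra.
  rewrite -(subrK (f x) (f z)) -addrA (le_lt_trans (ler_normD _ _))//.
  by rewrite distrC; lra.
have [d [d0 hd]] : exists d : R, 0 < d /\ K `<=` P d.
  have : \forall d \near (0 : R)^'+, 0 < d /\ K `<=` P d.
    by near=> d; split => //; near: d.
  by move=> /filter_ex[d ?]; exists d.
by exists d => // x y xK yK xy; apply: (hd x) => //=; rewrite /K/= in_itv.
Unshelve. all: by end_near. Qed.

Lemma segment_bounded (f : R -> R) (a b : R) : {within `[a, b], continuous f} ->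
  exists2 K, 0 < K & forall x, a <= x <= b -> `|f x| <= K.
Proof.
move=> cf; have cI : compact (f @` `[a, b]%classic).
  by apply: continuous_compact => //; exact: segment_compact.
have [K [_ hK]] := compact_bounded cI.
have K1 : K < `|K| + 1 by rewrite (le_lt_trans (ler_norm _))// ltrDl.
exists (`|K| + 1); first by rewrite ltr_wpDl.
by move=> x xb; apply: (hK _ K1); exists x => //=; rewrite in_itv.
Qed.

(** Bernstein's proof: uniform continuity and boundedness bound the oscillation
    of [f] by [e / 2] plus a multiple of the squared distance, whose mean under
    the walk is the variance. *)
Lemma weierstrass_approximation (f : R -> R) (b e : R) : 0 < b -> 0 < e ->
  {within `[0, b], continuous f} ->
  exists p : {poly R}, forall x, 0 <= x <= b -> `|f x - p.[x]| <= e.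
Proof.
move=> b0 e0 cf; have e20 : 0 < e / 2 by rewrite divr_gt0.
have [d d0 hd] := segment_unif_continuous cf e20.
have [K K0 hK] := segment_bounded cf.
have modulus x y : 0 <= x <= b -> 0 <= y <= b ->
    `|f x - f y| <= e / 2 + 2 * K / d ^+ 2 * (y - x) ^+ 2.
  move=> xb yb; have C0 : 0 <= 2 * K / d ^+ 2.
    by rewrite divr_ge0 ?sqr_ge0// mulr_ge0// ltW.
  have [xy|dxy] := ltP `|x - y| d.
    by rewrite (le_trans (ltW (hd _ _ xb yb xy)))// lerDl mulr_ge0 ?sqr_ge0.
  have h : `|f x - f y| <= 2 * K.
    rewrite (le_trans (ler_normB _ _))// mulr_natl mulr2n lerD ?hK//.
  apply: (le_trans h); rewrite -[leLHS]add0r lerD ?(ltW e20)//.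
  rewrite -mulrA ler_peMr ?mulr_ge0 ?(ltW K0)// mulrC ler_pdivlMr ?exprn_gt0// mul1r.
  by rewrite -(sqrrN (y - x)) opprB -(real_normK (num_real (x - y))) lerXn2r// nnegrE ltW.
pose C := 2 * K / d ^+ 2 * b ^+ 2.
have C0 : 0 <= C by rewrite mulr_ge0 ?sqr_ge0// divr_ge0 ?sqr_ge0// mulr_ge0// ltW.
pose n := (Num.truncn (C / (e / 2))).+1.
have n0 : 0 < n%:R :> R by rewrite ltr0n.
have nC : C / n%:R <= e / 2.
  rewrite ler_pdivrMr// mulrC -ler_pdivrMr//.
  have Ce : 0 <= C / (e / 2) by rewrite divr_ge0// ltW.
  by have /andP[_ /ltW] := truncn_itv Ce.
pose g (k : nat) := f (b * (k%:R / n%:R)).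
exists (bernstein n (b^-1 *: 'X) (fun k => (g k)%:P)) => x xb.
rewrite bernstein_horner hornerZ hornerX; set t := b^-1 * x.
have /andP[x0 xb'] := xb.
have t01 : 0 <= t <= 1.
  by rewrite /t mulr_ge0 ?invr_ge0 ?(ltW b0)//= mulrC ler_pdivrMr// mul1r.
have xt : x = b * t by rewrite /t mulVKf// lt0r_neq0.
pose q (k : nat) := e / 2 + C / n%:R ^+ 2 * (k%:R - n%:R * t) ^+ 2.
have qE : bernstein n t q <= e.
  rewrite /q bernsteinD bernstein_cst bernsteinZ bernstein_sq subrr expr0n addr0.
  have -> : C / n%:R ^+ 2 * (n%:R * t * (1 - t)) = C / n%:R * (t * (1 - t)).
    by field; exact: lt0r_neq0.
  have : t * (1 - t) <= 1 by move: t01 => /andP[]; nra.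
  have Cn : 0 <= C / n%:R by rewrite divr_ge0// ltW.
  move=> /(ler_wpM2l Cn); rewrite mulr1; lra.
have gq k : (k <= n)%N -> `|f x - g k| <= q k.
  move=> kn; have kb : 0 <= b * (k%:R / n%:R) <= b.
    rewrite mulr_ge0 ?divr_ge0 ?(ltW b0) ?(ltW n0)//=.
    by rewrite ler_piMr ?(ltW b0)// ler_pdivrMr// mul1r ler_nat.
  apply: le_trans (modulus _ _ xb kb) _; rewrite /q lerD2l xt le_eqVlt.
  by apply/orP; left; apply/eqP; rewrite /C; field; rewrite !lt0r_neq0.
have up : bernstein n t g <= f x + e.
  apply: (@le_trans _ _ (bernstein n t (fun k => f x + q k))).
    by apply: ler_bernstein => // k /gq; rewrite ler_norml => /andP[]; lra.
  by rewrite bernsteinD bernstein_cst lerD2l.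
have lo : f x <= bernstein n t g + e.
  apply: (@le_trans _ _ (bernstein n t (fun k => g k + q k))).
    rewrite -[leLHS](bernstein_cst n t (f x)).
    by apply: ler_bernstein => // k /gq; rewrite ler_norml => /andP[]; lra.
  by rewrite bernsteinD lerD2l.
by rewrite ler_norml; apply/andP; split; lra.
Qed.

End weierstrass.

(** * Convergence in mean of linear statistics *)

Section empirical_integral.
Context {R : realType}.

Lemma integral_empirical_measure (N : nat) (l : nat -> R) (D : set R) (f : R -> R) :
  measurable D -> measurable_fun D f -> (forall i : 'I_N, D (l i / N%:R)) ->
  \int[empirical_measure N l]_(x in D) f x =
  N%:R^-1 * \sum_(i < N) f (l i / N%:R).
Proof.
move=> mD mf lD.
have ge0 (g : R -> R) : (forall x, 0 <= g x) -> measurable_fun D g ->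
    (\int[empirical_measure N l]_(x in D) (g x)%:E =
     (N%:R^-1 * \sum_(i < N) g (l i / N%:R))%:E)%E.
  move=> g0 mg; have mg' : measurable_fun D (fun x => (g x)%:E) by exact/measurable_EFinP.
  rewrite /empirical_measure ge0_integral_mscale//=; last by move=> x _; rewrite lee_fin.
  rewrite (ge0_integral_measure_sum _ mD)//; last by move=> x _; rewrite lee_fin.
  rewrite EFinM -sumEFin; congr (_ * _)%E; apply: eq_bigr => i _.
  by rewrite integral_dirac// diracE mem_set ?mul1e.
pose fp x := Num.max (f x) 0; pose fn x := Num.max (- f x) 0.
rewrite /Rintegral integralE.
have -> : (\int[empirical_measure N l]_(x in D) ((fun x => (f x)%:E)^\+ x) =
    \int[empirical_measure N l]_(x in D) (fp x)%:E)%E.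
  by apply: eq_integral => x _; rewrite funeposE EFin_max.
have -> : (\int[empirical_measure N l]_(x in D) ((fun x => (f x)%:E)^\- x) =
    \int[empirical_measure N l]_(x in D) (fn x)%:E)%E.
  by apply: eq_integral => x _; rewrite funenegE EFin_max EFinN.
rewrite ge0; last 2 first.
- by move=> x; rewrite le_max lexx orbT.
- by apply: measurable_maxr.
rewrite ge0; last 2 first.
- by move=> x; rewrite le_max lexx orbT.
- by apply: measurable_maxr => //; exact: measurableT_comp.
rewrite -EFinB /= -mulrBr -sumrB; congr (_ * _); apply: eq_bigr => i _.
rewrite /fp /fn; case: (leP 0 (f (l i / N%:R))) => h.
  by rewrite max_r ?subr0// oppr_le0.
by rewrite max_l ?sub0r ?opprK// oppr_ge0 ltW.
Qed.

End empirical_integral.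

Section mean_convergence.
Context {R : realType}.
Local Notation mu := (@lebesgue_measure R).
Variables theta M : R.
Hypotheses (theta_gt0 : 0 < theta) (M_gt0 : 0 < M).

Local Notation B := (M + theta).
Local Notation phi := (limit_density theta M).
Local Notation D := (`[0, +oo[%classic : set R).
Local Notation K := (fun N => Num.truncn (M * N%:R)).

Definition empirical_mean N (f : R -> R) (lam : box_partition N (K N)) : R :=
  N%:R^-1 * \sum_(i < N) f (ell theta lam i / N%:R).

Definition limit_mean (f : R -> R) : R := \int[mu]_(x in D) (f x * phi x).

Definition mean_deviation (f : R -> R) N : R :=
  \sum_(lam : box_partition N (K N))
    ensemble_pmf theta lam * `|empirical_mean f lam - limit_mean f|.

(** Convergence in mean rather than in probability: the mean deviation is
    subadditive in [f], so that these functions form a vector space closed under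
    uniform limits. Integrability makes [limit_mean] linear on them. *)
Definition converges_in_mean (f : R -> R) : Prop :=
  mu.-integrable D (fun x => (f x * phi x)%:E) /\
  mean_deviation f N @[N --> \oo] --> (0 : R).

Lemma ell_scaled_bounds N (lam : box_partition N (K N)) (i : 'I_N) :
  0 <= ell theta lam i / N%:R <= B.
Proof.
have n0 : 0 < N%:R :> R by rewrite ltr0n (leq_ltn_trans _ (ltn_ord i)).
rewrite (divr_ge0 (ell_ge0 theta_gt0 lam i) (ltW n0))/=.
rewrite ler_pdivrMr// (le_trans (ell_le theta_gt0 lam (ltn_ord i)))//.
have MN : 0 <= M * N%:R by rewrite mulr_ge0// ltW.
have /andP[+ _] := truncn_itv MN; have t0 := theta_gt0.
by rewrite mulrBl mul1r mulrDl (mulrC theta); lra.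
Qed.

Lemma mean_deviation_ge0 f N : 0 <= mean_deviation f N.
Proof.
by apply: sumr_ge0 => lam _; rewrite mulr_ge0// ltW// ensemble_pmf_gt0.
Qed.

Let sum_pmf (b : R) N :
  \sum_(lam : box_partition N (K N)) ensemble_pmf theta lam * b = b.
Proof. by rewrite -mulr_suml ensemble_pmf_sum1// mul1r. Qed.

Let cvg0_le (u v : nat -> R) : (forall n, 0 <= u n <= v n) ->
  v n @[n --> \oo] --> (0 : R) -> u n @[n --> \oo] --> (0 : R).
Proof.
move=> uv v0; apply: (squeeze_cvgr _ (cvg_cst 0) v0).
by apply: nearW => n; exact: uv.
Qed.

Lemma converges_in_mean_linear f g (b : R) :
  converges_in_mean f -> converges_in_mean g ->
  converges_in_mean (fun x => f x + b * g x).
Proof.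
move=> [iF cF] [iG cG].
have mD : measurable D by exact: measurable_itv.
have iG' : mu.-integrable D (fun x => (b * (g x * phi x))%:E).
  exact: (@integrableZl _ _ R mu _ mD b _ iG).
have E : (fun x => ((f x + b * g x) * phi x)%:E) =
    (fun x => (f x * phi x)%:E + (b * (g x * phi x))%:E)%E.
  by apply/funext => x; rewrite -EFinD mulrDl mulrA.
split; first by rewrite E; exact: (@integrableD _ _ R mu _ mD _ _ iF iG').
have lE : limit_mean (fun x => f x + b * g x) = limit_mean f + b * limit_mean g.
  rewrite /limit_mean -(@RintegralZl _ _ R mu _ _ b mD iG).
  rewrite -(@RintegralD _ _ R mu _ _ _ mD iF iG').
  by apply: eq_Rintegral => x _; rewrite mulrDl mulrA.
apply: (@cvg0_le _ (fun N => mean_deviation f N + `|b| * mean_deviation g N)); last first.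
  rewrite -[X in _ --> X]addr0 -[X in _ --> _ + X](mulr0 `|b|).
  by apply: cvgD => //; apply: cvgM => //; exact: cvg_cst.
move=> N; rewrite mean_deviation_ge0 /= /mean_deviation mulr_sumr -big_split/=.
apply: ler_sum => lam _; rewrite mulrCA -mulrDr.
rewrite ler_wpM2l//; first by rewrite ltW// ensemble_pmf_gt0.
rewrite lE (_ : _ - _ = (empirical_mean f lam - limit_mean f) +
  b * (empirical_mean g lam - limit_mean g)).
  by rewrite (le_trans (ler_normD _ _))// normrM.
rewrite /empirical_mean big_split/= -mulr_sumr.
by move: (\sum_(i < N) _) (\sum_(i < N) _) => u v; ring.
Qed.

Lemma converges_in_mean_eq f g : (forall x, 0 <= x -> f x = g x) ->
  converges_in_mean f -> converges_in_mean g.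
Proof.
move=> fg [iF cF].
have fgD x : x \in D -> f x = g x by rewrite inE/= in_itv/= andbT; exact: fg.
split; first by apply: eq_integrable iF => // x xD; rewrite fgD.
rewrite (_ : mean_deviation g = mean_deviation f)//; apply/funext => N.
apply: eq_bigr => lam _; congr (_ * `|_ - _|).
  congr (_ * _); apply: eq_bigr => i _; rewrite fg//.
  by have /andP[] := ell_scaled_bounds lam i.
by apply: eq_Rintegral => x xD; rewrite fgD.
Qed.

Lemma converges_in_mean_scale f (b : R) :
  converges_in_mean f -> converges_in_mean (fun x => b * f x).
Proof.
move=> cF; apply: converges_in_mean_eq (converges_in_mean_linear (b - 1) cF cF).
by move=> x _; ring.
Qed.

Let mass := limit_mean (fun=> 1).

Let mass_ge0 : 0 <= mass.
Proof.
apply: Rintegral_ge0 => x _; rewrite mul1r.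
by have /andP[] := limit_density_bounds M theta_gt0 x.
Qed.

Let limit_mean_dist f g (e : R) :
  mu.-integrable D (fun x => (f x * phi x)%:E) ->
  mu.-integrable D (fun x => (g x * phi x)%:E) ->
  (forall x, 0 <= x <= B -> `|f x - g x| <= e) ->
  `|limit_mean f - limit_mean g| <= e * mass.
Proof.
move=> iF iG fge; have mD : measurable D by exact: measurable_itv.
have i1 : mu.-integrable D (fun x => (1 * phi x)%:E).
  apply: (integrable_limit_density theta_gt0 M_gt0 (K := 1)) => // x _.
  by rewrite normr1.
rewrite /limit_mean -(@RintegralB _ _ R mu _ _ _ mD iF iG).
have iB := @integrableB _ _ R mu _ mD _ _ iF iG.
apply: le_trans (@le_normr_Rintegral _ _ R mu D _ mD iB) _.
rewrite /mass /limit_mean -(@RintegralZl _ _ R mu _ _ e mD i1).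
apply: (@le_Rintegral _ _ R mu D _ _ mD).
- exact: (@integrable_abse _ _ R mu D _ iB).
- exact: (@integrableZl _ _ R mu _ mD e _ i1).
- move=> x; rewrite /= in_itv/= andbT => x0.
  have /andP[p0 _] := limit_density_bounds M theta_gt0 x.
  rewrite -mulrBl normrM (ger0_norm p0) mul1r.
  have [xB|/negP xB] := boolP (0 <= x <= B).
    by rewrite ler_wpM2r// fge.
  by rewrite limit_density_out// !mulr0.
Qed.

Lemma converges_in_mean_uniform f :
  mu.-integrable D (fun x => (f x * phi x)%:E) ->
  (forall e, 0 < e -> exists2 g, converges_in_mean g &
     forall x, 0 <= x <= B -> `|f x - g x| <= e) ->
  converges_in_mean f.
Proof.
move=> iF approx; split=> //; apply/cvgr0Pnorm_le => e e0.
have m1 : 0 < 2 * (1 + mass) by rewrite mulr_gt0// ltr_pwDl.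
have [g [iG cG] fg] := approx _ (divr_gt0 e0 m1).
have e20 : 0 < e / 2 by rewrite divr_gt0.
move/cvgr0Pnorm_le : cG => /(_ _ e20); apply: filterS => N.
rewrite !ger0_norm ?mean_deviation_ge0// => dG.
set d := e / _ in fg.
have dE : d * (1 + mass) = e / 2 by rewrite /d; field; rewrite gt_eqF// ltr_pwDl.
apply: (@le_trans _ _ (mean_deviation g N + d * (1 + mass))); last first.
  by rewrite dE; lra.
rewrite /mean_deviation -[X in _ <= _ + X](sum_pmf _ N) -big_split/=.
apply: ler_sum => lam _; rewrite -mulrDr ler_wpM2l//.
  by rewrite ltW// ensemble_pmf_gt0.
have h1 : `|empirical_mean f lam - empirical_mean g lam| <= d.
  have d0 : 0 <= d by rewrite ltW// divr_gt0.
  rewrite /empirical_mean -mulrBr -sumrB normrM normfV (ger0_norm (ler0n _ N)).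
  have [N0|N0] := posnP N.
    by rewrite [X in X * _](_ : _ = 0) ?mul0r// N0 invr0.
  rewrite mulrC ler_pdivrMr ?ltr0n//.
  apply: le_trans (ler_norm_sum _ _ _) _.
  apply: (@le_trans _ _ (\sum_(i < N) d)); last first.
    by rewrite sumr_const card_ord mulr_natr.
  by apply: ler_sum => i _; apply: fg; exact: ell_scaled_bounds.
have h2 := limit_mean_dist iF iG fg.
rewrite (_ : _ - _ = (empirical_mean f lam - empirical_mean g lam) +
  ((empirical_mean g lam - limit_mean g) - (limit_mean f - limit_mean g))); last by ring.
apply: le_trans (ler_normD _ _) _.
have := ler_normB (empirical_mean g lam - limit_mean g) (limit_mean f - limit_mean g).
by rewrite mulrDr mulr1; lra.
Qed.

(** With [d] half the target error, this takes the place of the Cauchy-Schwarz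
    inequality between the mean deviation and the mean square. *)
Let young (d v : R) : 0 < d -> v <= d + d^-1 * v ^+ 2.
Proof.
move=> d0; rewrite -subr_ge0.
have -> : d + d^-1 * v ^+ 2 - v = d^-1 * (d ^+ 2 - v * d + v ^+ 2).
  by field; exact: lt0r_neq0.
by rewrite mulr_ge0 ?invr_ge0 ?(ltW d0)//; nra.
Qed.

Lemma converges_in_mean_resolvent (s : R) : 0 < s ->
  converges_in_mean (fun x => (x + s)^-1).
Proof.
move=> s0; split.
  apply: (integrable_limit_density theta_gt0 M_gt0 (K := s^-1)).
    apply: measurable_funTS; apply: (@measurableT_comp _ _ _ _ _ _ (fun x : R => x^-1)).
      exact: measurable_invr.
    exact: measurable_funD.
  move=> x /andP[x0 _]; have xs : 0 < x + s by rewrite ltr_wpDl.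
  by rewrite ger0_norm ?invr_ge0 ?(ltW xs)// lef_pV2 ?posrE// lerDr.
pose S := limit_mean (fun x => (x + s)^-1).
have [S0 psiS] : 0 <= S /\ loop_function theta M s S = 0.
  exact: loop_function_limit.
have [C hC] := mean_square_bound theta_gt0 M_gt0 s0 S0 psiS.
apply/cvgr0Pnorm_le => e e0.
have e20 : 0 < e / 2 by rewrite divr_gt0.
near=> N.
have N0 : (0 < N)%N by near: N; exact: nbhs_infty_gt.
have n0 : 0 < N%:R :> R by rewrite ltr0n.
have tN : theta <= s * N%:R.
  by rewrite mulrC -ler_pdivrMr//; near: N; exact: nbhs_infty_ger.
have CN : C / N%:R <= (e / 2) ^+ 2.
  rewrite ler_pdivrMr// mulrC -ler_pdivrMr ?exprn_gt0//.
  by near: N; exact: nbhs_infty_ger.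
rewrite ger0_norm ?mean_deviation_ge0//.
have XE (lam : box_partition N (K N)) : empirical_mean (fun x => (x + s)^-1) lam =
    resolvent_sum theta (s * N%:R) lam.
  rewrite /empirical_mean /resolvent_sum mulr_sumr; apply: eq_bigr => i _.
  have l0 := ell_ge0 theta_gt0 lam i; have sn : 0 < s * N%:R by rewrite mulr_gt0.
  by field; rewrite !lt0r_neq0// ltr_wpDr// ltr_wpDl.
have := hC N N0 tN; move: CN; set c := C / N%:R => CN h.
have {}h := le_trans h CN.
apply: (@le_trans _ _ (\sum_(lam : box_partition N (K N)) (ensemble_pmf theta lam * (e / 2) +
    (e / 2)^-1 * (ensemble_pmf theta lam * (resolvent_sum theta (s * N%:R) lam - S) ^+ 2)))).
  apply: ler_sum => lam _; rewrite XE [X in _ <= _ + X]mulrCA -mulrDr ler_wpM2l//.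
    by rewrite ltW// ensemble_pmf_gt0.
  rewrite -/S -(real_normK (num_real (resolvent_sum _ _ _ - S))).
  exact: young.
rewrite big_split/= sum_pmf -mulr_sumr.
have : (e / 2)^-1 * \sum_(lam : box_partition N (K N))
    ensemble_pmf theta lam * (resolvent_sum theta (s * N%:R) lam - S) ^+ 2 <= e / 2.
  by rewrite ler_pdivrMl// -expr2.
by lra.
Unshelve. all: by end_near. Qed.

End mean_convergence.

(** * Continuous test functions *)

Section continuous_test_functions.
Context {R : realType}.
Variables theta M : R.
Hypotheses (theta_gt0 : 0 < theta) (M_gt0 : 0 < M).

Local Notation B := (M + theta).
Local Notation phi := (limit_density theta M).
Local Notation D := (`[0, +oo[%classic : set R).
Local Notation converges := (converges_in_mean theta M).

(** Multiplication by [x] is reached from the resolvents alone: [x ^+ k] is the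
    limit of [t * x ^+ k / (x + t)] as [t] grows, uniformly on segments, and
    [x ^+ k.+1 / (x + s) = x ^+ k - s * x ^+ k / (x + s)] on the half-line. *)
Lemma converges_in_mean_expn_resolvent k (s : R) : 0 < s ->
  converges (fun x => x ^+ k * (x + s)^-1).
Proof.
elim: k s => [|k IH] s s0.
  have := converges_in_mean_resolvent theta_gt0 M_gt0 s0.
  apply: (converges_in_mean_eq theta_gt0 M_gt0) => x _.
  by rewrite expr0 mul1r.
have cXk : converges (fun x => x ^+ k).
  apply: (converges_in_mean_uniform theta_gt0 M_gt0).
    apply: (integrable_limit_density theta_gt0 M_gt0 (K := B ^+ k)).
      by apply: measurable_funTS; exact: measurable_funX.
    move=> x /andP[x0 xB]; rewrite ger0_norm ?exprn_ge0//.
    by apply: lerXn2r; rewrite ?nnegrE// (le_trans x0).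
  move=> e e0; have B0 : 0 < B by rewrite addr_gt0.
  pose t := B ^+ k.+1 / e; have t0 : 0 < t by rewrite divr_gt0// exprn_gt0.
  exists (fun x => t * (x ^+ k * (x + t)^-1)).
    by apply: (converges_in_mean_scale theta_gt0 M_gt0); exact: IH.
  move=> x /andP[x0 xB]; have xt : 0 < x + t by rewrite ltr_wpDl.
  have -> : x ^+ k - t * (x ^+ k * (x + t)^-1) = x ^+ k.+1 / (x + t).
    by rewrite exprS; field; exact: lt0r_neq0.
  rewrite ger0_norm; last by rewrite divr_ge0 ?exprn_ge0 ?(ltW xt).
  rewrite ler_pdivrMr// (@le_trans _ _ (e * t))//; last by rewrite ler_pM2l// lerDr.
  rewrite /t mulrC divfK ?lt0r_neq0//.
  by apply: lerXn2r; rewrite ?nnegrE// ltW.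
have := converges_in_mean_linear theta_gt0 (- s) cXk (IH s s0).
apply: (converges_in_mean_eq theta_gt0 M_gt0) => x x0; have xs : 0 < x + s by rewrite ltr_wpDl.
by rewrite exprS; field; exact: lt0r_neq0.
Qed.

Lemma converges_in_mean_expn k : converges (fun x => x ^+ k).
Proof.
have := converges_in_mean_linear theta_gt0 1
  (converges_in_mean_expn_resolvent k.+1 (@ltr01 R))
  (converges_in_mean_expn_resolvent k (@ltr01 R)).
apply: (converges_in_mean_eq theta_gt0 M_gt0) => x x0.
have x1 : 0 < x + 1 by rewrite ltr_wpDl.
by rewrite exprS; field; exact: lt0r_neq0.
Qed.

Lemma converges_in_mean_horner (p : {poly R}) : converges (horner p).
Proof.
have h n : converges (fun x => \sum_(i < n) p`_i * x ^+ i).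
  elim: n => [|n IH].
    have := converges_in_mean_scale theta_gt0 M_gt0 0 (converges_in_mean_expn 0).
    by apply: (converges_in_mean_eq theta_gt0 M_gt0) => x _; rewrite big_ord0 mul0r.
  have := converges_in_mean_linear theta_gt0 p`_n IH (converges_in_mean_expn n).
  by apply: (converges_in_mean_eq theta_gt0 M_gt0) => x _; rewrite big_ord_recr.
have := h (size p); apply: (converges_in_mean_eq theta_gt0 M_gt0) => x _.
by rewrite horner_coef.
Qed.

Lemma converges_in_mean_continuous (f : R -> R) : {within D, continuous f} ->
  measurable_fun D f /\ converges f.
Proof.
move=> cf; have B0 : 0 < B by rewrite addr_gt0.
have cfB : {within `[0, B], continuous f}.
  apply: continuous_subspaceW cf => x /=; rewrite !in_itv/= andbT.
  by case/andP.
have mf : measurable_fun D f.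
  by apply: subspace_continuous_measurable_fun => //; exact: measurable_itv.
split=> //; have [K _ hK] := segment_bounded cfB.
apply: (converges_in_mean_uniform theta_gt0 M_gt0).
  exact: (integrable_limit_density theta_gt0 M_gt0 mf hK).
move=> e e0; have [p hp] := weierstrass_approximation B0 e0 cfB.
by exists (horner p) => //; exact: converges_in_mean_horner.
Qed.

Lemma ensemble_prob_markov N K (X : box_partition N K -> R) (e : R) : 0 < e ->
  (0 <= ensemble_prob theta_gt0 (N := N) (M := K) [set lam | (e <= `|X lam|)%R] <=
   (e^-1 * \sum_lam ensemble_pmf theta lam * `|X lam|)%:E)%E.
Proof.
move=> e0; rewrite /ensemble_prob; apply/andP; split.
  by apply: fsume_ge0 => lam _; rewrite lee_fin ltW// ensemble_pmf_gt0.
rewrite fsbig_mkcond (fsbigE (index_enum (box_partition N K))); last 3 first.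
- exact: index_enum_uniq.
- by [].
- by move=> lam _; rewrite mem_index_enum.
under eq_bigl do rewrite in_setT.
rewrite mulr_sumr -sumEFin; apply: lee_sum => lam _.
have p0 : 0 <= ensemble_pmf theta lam by rewrite ltW// ensemble_pmf_gt0.
rewrite /patch; case: ifPn => [|_]; last first.
  by rewrite lee_fin mulr_ge0 ?invr_ge0 ?(ltW e0)// mulr_ge0.
rewrite inE/= => eX; rewrite lee_fin mulrCA ler_peMr//.
by rewrite mulrC ler_pdivlMr// mul1r.
Qed.

End continuous_test_functions.

Theorem proposition6p5 (R : realType) (M theta : R)
    (M_gt0 : 0 < M) (theta_gt0 : 0 < theta) :
  let M_ (N : nat) := Num.truncn (M * N%:R) in
  weakly_cvg_in_probability
    (fun N => ensemble_prob theta_gt0 (N := N) (M := M_ N))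
    (fun N lam => empirical_measure N (ell theta lam))
    (limit_density theta M).
Proof.
move=> M_ f cf _ e e0.
have [mf [_ cvgf]] := converges_in_mean_continuous theta_gt0 M_gt0 cf.
have mD : measurable (`[0, +oo[%classic : set R) by exact: measurable_itv.
apply: (@squeeze_cvge _ _ _ _ (fun=> 0%E) _ (fun N => (e^-1 * mean_deviation theta M f N)%:E)).
- apply: nearW => N.
  have XE (lam : box_partition N (M_ N)) :
      \int[empirical_measure N (ell theta lam)]_(x in `[0, +oo[) f x =
      empirical_mean theta f lam.
    apply: integral_empirical_measure => // i; rewrite /= in_itv/= andbT.
    by have /andP[] := ell_scaled_bounds theta_gt0 M_gt0 lam i.
  under eq_fun do rewrite XE.
  exact: (ensemble_prob_markov theta_gt0 (fun lam : box_partition N (M_ N) =>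
    empirical_mean theta f lam - limit_mean theta M f) e0).
- exact: cvg_cst.
- apply: cvg_EFin; first exact: nearW.
  rewrite -[X in _ --> X](mulr0 e^-1).
  by apply: cvgM => //; exact: cvg_cst.
Qed.
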